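(* Let $n=2$ and let the cost structure be separable. Then: (a) if marginal investment costs are sufficiently convex, the relaxed problem (P2) is solved by right-censored allocation and quality functions, for some threshold $\theta_0\in[0,1]$; (b) if marginal investment costs are sufficiently concave, (P2) is solved by left-censored allocation and quality functions, for some threshold $\theta_0\in[0,1]$.
   Context: Setting. Two firms have types $\theta_i\in[0,1]$, i.i.d. with cdf $F$ and strictly positive density $f$; $J(\theta)=\theta+F(\theta)/f(\theta)$ is strictly increasing. Separable cost structure: the buyer's value of quality is $V(q)=q$, the production cost is $C^P(q,\theta)=\alpha\theta$ with $\alpha>0$, the investment cost is $C^I(q,\theta)=g(q)$ with $g(0)=g'(0)=0$, $g'(q)>0$ and $g''(q)>0$ for $q>0$, and $g'(q)>1$ for all large $q$. Relaxed problem (P2): maximize $\mathbb E\sum_{i=1}^2\big((q_i(\theta_i)-\alpha J(\theta_i))z_i(\bm\theta)-g(q_i(\theta_i))\big)$ over quality functions $q_i(\theta_i)\ge0$ (each depending on own type only) and allocation functions $z_i(\bm\theta)\ge0$ with $z_1+z_2=1$. Let $\xi(z)=1-J(F^{-1}(1-z))$, $z\in[0,1]$. Marginal investment costs are sufficiently convex (resp. sufficiently concave) if $q\mapsto\alpha\,\xi(g'(q))-q$ is strictly quasi-convex (resp. strictly quasi-concave), on the $q\ge0$ with $g'(q)\le1$. Let $q^*_{sym}(\theta)=(g')^{-1}(1-F(\theta))$. Right-censored functions with threshold $\theta_0$: with $\tilde\theta_1=\min(\theta_0,\theta_1)$, $z_1(\bm\theta)=\mathbb I(\tilde\theta_1<\theta_2)$,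 $z_2=1-z_1$, $q_1(\theta_1)=q^*_{sym}(\tilde\theta_1)$, and $q_2(\theta_2)=q^*_{sym}(\theta_2)$ if $\theta_2<\theta_0$, $q_2(\theta_2)=q^*_{sym}(1)=0$ if $\theta_2>\theta_0$. Left-censored functions with threshold $\theta_0$: with $\tilde\theta_2=\max(\theta_0,\theta_2)$, $z_2(\bm\theta)=\mathbb I(\tilde\theta_2<\theta_1)$, $z_1=1-z_2$, $q_2(\theta_2)=q^*_{sym}(\tilde\theta_2)$, and $q_1(\theta_1)=q^*_{sym}(\theta_1)$ if $\theta_1>\theta_0$, $q_1(\theta_1)=q^*_{sym}(0)$ if $\theta_1<\theta_0$. *)

(* Defs.v *)
From HB Require Import structures.
From mathcomp Require Import all_boot all_order all_algebra.
From mathcomp Require Import all_classical all_reals all_analysis.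

Set Implicit Arguments.
Unset Strict Implicit.
Unset Printing Implicit Defensive.

Import Order.TTheory GRing.Theory Num.Theory.
Import numFieldNormedType.Exports.

Local Open Scope classical_set_scope.
Local Open Scope ring_scope.

Section Types.
Variables (R : realType) (mu : probability (measurableTypeR R) R) (f : R -> R).

(* mu is the law of one firm's type; the two types are i.i.d., so the type
   profile has law mu \x mu. *)
Record type_law : Prop := TypeLaw {
  density_measurable : measurable_fun (`[0, 1]%classic : set R) f ;
  density_gt0 : forall x : R, x \in `[0, 1] -> 0 < f x ;
  densityP : forall A : set R, measurable A ->
    mu A = (\int[lebesgue_measure]_(x in A `&` `[0%R, 1%R]%classic) (f x)%:E)%E }.

Definition F (x : R) : R := fine (mu `]-oo, x]%classic).

Definition F_inv : R -> R := 'pinv_(fun=> 0) `[0, 1]%classic F.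

Definition J (x : R) : R := x + F x / f x.

Definition xi (z : R) : R := 1 - J (F_inv (1 - z)).

End Types.

(* Only the values of g and g' on [0, +oo[ are constrained: g' is the
   derivative of g on ]0, +oo[ and its right derivative at 0. *)
Record investment_cost (R : realType) (g g' : R -> R) : Prop :=
  InvestmentCost {
  g_at0 : g 0 = 0 ;
  g'_at0 : g' 0 = 0 ;
  g_rderiv0 : h^-1 * (g h - g 0) @[h --> 0^'+] --> g' 0 ;
  g_deriv : forall q : R, 0 < q -> is_derive q 1 g (g' q) ;
  g'_gt0 : forall q : R, 0 < q -> 0 < g' q ;
  g'_derivable : forall q : R, 0 < q -> derivable g' q 1 ;
  g''_gt0 : forall q : R, 0 < q -> 0 < derive1 g' q ;
  g'_large : \forall q \near +oo, 1 < g' q }.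

Definition strictly_quasi_convex (R : realType) (A : set R) (h : R -> R) :=
  forall x y t : R, A x -> A y -> x != y -> 0 < t < 1 ->
    h (t * x + (1 - t) * y) < Num.max (h x) (h y).

Definition strictly_quasi_concave (R : realType) (A : set R) (h : R -> R) :=
  forall x y t : R, A x -> A y -> x != y -> 0 < t < 1 ->
    Num.min (h x) (h y) < h (t * x + (1 - t) * y).

Section Problem.
Variables (R : realType) (mu : probability (measurableTypeR R) R).
Variables (f g g' : R -> R) (alpha : R).

Definition sufficiently_convex :=
  strictly_quasi_convex [set q | 0 <= q /\ g' q <= 1]
    (fun q => alpha * xi mu f (g' q) - q).

Definition sufficiently_concave :=
  strictly_quasi_concave [set q | 0 <= q /\ g' q <= 1]
    (fun q => alpha * xi mu f (g' q) - q).

Definition q_sym (x : R) : R :=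
  'pinv_(fun=> 0) `[0, +oo[%classic g' (1 - F mu x).

Definition type_profiles : set (R * R) := `[0, 1]%classic `*` `[0, 1]%classic.

Record feasible (q1 q2 : R -> R) (z1 z2 : R * R -> R) : Prop := Feasible {
  q1_measurable : measurable_fun (`[0, 1]%classic : set R) q1 ;
  q2_measurable : measurable_fun (`[0, 1]%classic : set R) q2 ;
  z1_measurable : measurable_fun type_profiles z1 ;
  z2_measurable : measurable_fun type_profiles z2 ;
  q1_ge0 : forall x : R, x \in `[0, 1] -> 0 <= q1 x ;
  q2_ge0 : forall x : R, x \in `[0, 1] -> 0 <= q2 x ;
  z1_ge0 : forall t, type_profiles t -> 0 <= z1 t ;
  z2_ge0 : forall t, type_profiles t -> 0 <= z2 t ;
  z_sum1 : forall t, type_profiles t -> z1 t + z2 t = 1 }.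

(* For feasible functions the integrand is bounded above, because g' > 1 for
   all large qualities; so the expectation is always meaningful, with value
   -oo when the integrand is not integrable. *)
Definition objective (q1 q2 : R -> R) (z1 z2 : R * R -> R) : \bar R :=
  (\int[mu \x mu]_(t in type_profiles)
     (((q1 t.1 - alpha * J mu f t.1) * z1 t - g (q1 t.1))
      + ((q2 t.2 - alpha * J mu f t.2) * z2 t - g (q2 t.2)))%R%:E)%E.

Definition solves_P2 (q1 q2 : R -> R) (z1 z2 : R * R -> R) : Prop :=
  feasible q1 q2 z1 z2 /\
  forall p1 p2 y1 y2, feasible p1 p2 y1 y2 ->
    (objective p1 p2 y1 y2 <= objective q1 q2 z1 z2)%E.

(* The quality of firm 2 at the threshold itself is left unspecified, and so
   is that of firm 1 in left_censored. *)
Record right_censored (x0 : R) (q1 q2 : R -> R) (z1 z2 : R * R -> R) : Prop :=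
  RightCensored {
  rc_z1 : forall t, type_profiles t -> z1 t = (Num.min x0 t.1 < t.2)%R%:R ;
  rc_z2 : forall t, type_profiles t -> z2 t = 1 - z1 t ;
  rc_q1 : forall x : R, x \in `[0, 1] -> q1 x = q_sym (Num.min x0 x) ;
  rc_q2_lt : forall x : R, x \in `[0, 1] -> x < x0 -> q2 x = q_sym x ;
  rc_q2_gt : forall x : R, x \in `[0, 1] -> x0 < x -> q2 x = q_sym 1 }.

Record left_censored (x0 : R) (q1 q2 : R -> R) (z1 z2 : R * R -> R) : Prop :=
  LeftCensored {
  lc_z2 : forall t, type_profiles t -> z2 t = (Num.max x0 t.2 < t.1)%R%:R ;
  lc_z1 : forall t, type_profiles t -> z1 t = 1 - z2 t ;
  lc_q2 : forall x : R, x \in `[0, 1] -> q2 x = q_sym (Num.max x0 x) ;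
  lc_q1_gt : forall x : R, x \in `[0, 1] -> x0 < x -> q1 x = q_sym x ;
  lc_q1_lt : forall x : R, x \in `[0, 1] -> x < x0 -> q1 x = q_sym 0 }.

End Problem.

(* Main.v *)
Require Import Defs.
From mathcomp Require Import all_boot all_order all_algebra.
From mathcomp Require Import all_classical all_reals all_analysis.
From mathcomp Require Import measurable_realfun ring lra.
Import Order.TTheory GRing.Theory Num.Theory.
Import numFieldNormedType.Exports.
Local Open Scope classical_set_scope.
Local Open Scope ring_scope.
Set Implicit Arguments.
Unset Strict Implicit.
Unset Printing Implicit Defensive.

(* Given the allocation, the best qualities turn the objective into the expected
   convex conjugate of [g] at the interim winning probabilities minus the expected
   cost of the winner.  By majorization, any pair of interim probabilities can be
   replaced, without loss, by a nonincreasing function [T] and its generalized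
   inverse [dag T], i.e. by a deterministic allocation monotone in both types; for
   such a pair the layer-cake formula for the conjugate makes the objective linear:
   up to a constant it is the expectation of [kappa = - alpha J - q_sym] at the
   winner's type.  Myerson ironing then applies: monotonicity of the winning
   probabilities allows [kappa] to be replaced by a nonincreasing [kbar], and giving
   victory to the larger [kbar] is optimal.  When [kappa] is quasi-convex
   (quasi-concave), ironing pools an interval of high (low) types, and the
   right-censored (left-censored) functions allocate by [kbar], are constant on the
   pool and use the best qualities, so they attain the bound. *)

(** * Expectations of bounded measurable functions *)

(** Once qualities are optimized out, each firm's payoff is convex in its winning probabilities, so
    first-order conditions do not locate a maximum. The way out is an exchange between the firms.
    The conjugate at a winning probability of firm 1 is an integral of [phi] (which is [q_sym]) over
    the types [t] with [surv t] below it; when firm 2's winning probabilities are the generalized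
    inverse of firm 1's, averaging gives each [t] the weight with which firm 2 of type [t] loses.
    What one firm gains from investment is thus forgone, type by type, when the other firm wins:
    this is the origin of the term [- q_sym] in [kappa]. The exchange also forces the asymmetry of
    the solutions. On the pool [kbar] does not separate the firms, but an even split there gives
    winning probabilities that are not generalized inverses of each other, and convexity turns this
    into a loss. Letting firm 1 win whenever both types are in the pool keeps the allocation of
    threshold form and makes both winning probabilities constant there, as equality in ironing
    requires. *)

Section BoundedMeasurable.
Context {R : realType} {d : measure_display} {T : measurableType d}.
Implicit Types h k : T -> R.

(** Boundedness makes integrability automatic under every probability, so linearity of [mean] and
    Fubini need no other hypothesis. *)
Definition bm h := measurable_fun setT h /\ exists M, forall x, `|h x| <= M.

Lemma bm_cst (r : R) : bm (fun=> r).
Proof. by split; [exact: measurable_cst | exists `|r|]. Qed.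

Lemma bmD h k : bm h -> bm k -> bm (fun x => h x + k x).
Proof.
move=> [mh [M hM]] [mk [N kN]]; split; first exact: measurable_funD.
by exists (M + N) => x; rewrite (le_trans (ler_normD _ _))// lerD.
Qed.

Lemma bmN h : bm h -> bm (fun x => - h x).
Proof.
move=> [mh [M hM]]; split; first exact: measurableT_comp.
by exists M => x; rewrite normrN.
Qed.

Lemma bmB h k : bm h -> bm k -> bm (fun x => h x - k x).
Proof. by move=> bh bk; apply: bmD => //; exact: bmN. Qed.

Lemma bmM h k : bm h -> bm k -> bm (fun x => h x * k x).
Proof.
move=> [mh [M hM]] [mk [N kN]]; split; first exact: measurable_funM.
by exists (M * N) => x; rewrite normrM ler_pM.
Qed.

Lemma bm_max h k : bm h -> bm k -> bm (fun x => Num.max (h x) (k x)).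
Proof.
move=> [mh [M hM]] [mk [N kN]]; split; first exact: measurable_maxr.
exists (Num.max M N) => x; rewrite /Num.max.
by case: ifP => _; rewrite le_max ?hM ?kN ?orbT.
Qed.

Lemma bm_min h k : bm h -> bm k -> bm (fun x => Num.min (h x) (k x)).
Proof.
move=> [mh [M hM]] [mk [N kN]]; split; first exact: measurable_minr.
exists (Num.max M N) => x; rewrite /Num.min.
by case: ifP => _; rewrite le_max ?hM ?kN ?orbT.
Qed.

Lemma bm_bool (b : T -> bool) : measurable_fun setT b -> bm (fun x => (b x)%:R).
Proof.
move=> mb; split.
  rewrite [X in measurable_fun _ X](_ : _ = (fun b : bool => b%:R) \o b)//.
  exact: measurableT_comp.
by exists 1 => x; case: (b x); rewrite ?normr1 ?normr0.
Qed.

Lemma bm_lt h k : bm h -> bm k -> bm (fun x => (h x < k x)%R%:R).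
Proof. by move=> [mh _] [mk _]; apply: bm_bool; exact: measurable_fun_ltr. Qed.

Lemma bm_le h k : bm h -> bm k -> bm (fun x => (h x <= k x)%R%:R).
Proof. by move=> [mh _] [mk _]; apply: bm_bool; exact: measurable_fun_ler. Qed.

End BoundedMeasurable.

Lemma bm_comp {R : realType} {d d'} {T : measurableType d}
    {T' : measurableType d'} (u : T' -> T) (h : T -> R) :
  measurable_fun setT u -> bm h -> bm (fun x => h (u x)).
Proof.
move=> mu [mh [M hM]]; split; first exact: (measurableT_comp mh mu).
by exists M => x; exact: hM.
Qed.

Lemma bm_fst {R : realType} {d d'} {T : measurableType d}
    {T' : measurableType d'} (h : T -> R) :
  bm h -> bm (fun t : T * T' => h t.1).
Proof. by apply: bm_comp; exact: measurable_fst. Qed.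

Lemma bm_snd {R : realType} {d d'} {T : measurableType d}
    {T' : measurableType d'} (h : T' -> R) :
  bm h -> bm (fun t : T * T' => h t.2).
Proof. by apply: bm_comp; exact: measurable_snd. Qed.

Lemma bm_pair2 {R : realType} {d d'} {T : measurableType d}
    {T' : measurableType d'} (h : T -> T' -> R) x :
  bm (fun t => h t.1 t.2) -> bm (h x).
Proof. move=> bh; apply: (@bm_comp _ _ _ _ _ (pair x) _ _ bh).
exact: pair1_measurable. Qed.

Lemma bm_swap {R : realType} {d d'} {T : measurableType d}
    {T' : measurableType d'} (h : T -> T' -> R) :
  bm (fun t => h t.1 t.2) -> bm (fun t => h t.2 t.1).
Proof. move=> bh; apply: (@bm_comp _ _ _ _ _ (fun t => (t.2, t.1)) _ _ bh).
exact: measurable_swap. Qed.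

Lemma bm_integrable {R : realType} {d} {T : measurableType d}
    (m : {measure set T -> \bar R}) (h : T -> R) :
  (m setT < +oo)%E -> bm h -> m.-integrable setT (EFin \o h).
Proof.
move=> mT [mh [M hM]]; apply: measurable_bounded_integrable => //.
exists M; split; first exact: num_real.
by move=> y My x _ /=; rewrite (le_trans (hM x))// ltW.
Qed.

Section Mean.
Context {R : realType} {d : measure_display} {T : measurableType d}.
Implicit Types h k : T -> R.

Variable P : probability T R.

Definition mean h : R := \int[P]_x h x.

Let Pfin : (P setT < +oo)%E.
Proof. by rewrite probability_setT ltry. Qed.

Lemma mean_EFin h : bm h -> (mean h)%:E = (\int[P]_x (h x)%:E)%E.
Proof.
move=> /(bm_integrable Pfin)/(@integrable_fin_num _ _ _ _ _ measurableT).
by move=> /fineK.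
Qed.

Lemma mean_ext h k : h =1 k -> mean h = mean k.
Proof. by move=> hk; congr (mean _); exact/funext. Qed.

Lemma mean_cst r : mean (fun=> r) = r.
Proof.
rewrite /mean Rintegral_cst// -[RHS]mulr1; congr (_ * _).
by rewrite -[RHS]/(fine 1%E); congr fine; exact: probability_setT.
Qed.

Lemma meanD h k : bm h -> bm k ->
  mean (fun x => h x + k x) = mean h + mean k.
Proof. by move=> *; apply: RintegralD => //; exact: bm_integrable. Qed.

Lemma meanB h k : bm h -> bm k ->
  mean (fun x => h x - k x) = mean h - mean k.
Proof. by move=> *; apply: RintegralB => //; exact: bm_integrable. Qed.

Lemma meanZ r h : bm h -> mean (fun x => r * h x) = r * mean h.
Proof. by move=> *; apply: RintegralZl => //; exact: bm_integrable. Qed.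

Lemma meanZr r h : bm h -> mean (fun x => h x * r) = mean h * r.
Proof. by move=> *; apply: RintegralZr => //; exact: bm_integrable. Qed.

Lemma le_mean h k : bm h -> bm k -> (forall x, h x <= k x) ->
  mean h <= mean k.
Proof. by move=> *; apply: le_Rintegral => //; exact: bm_integrable. Qed.

Lemma mean_norm_le h M : bm h -> (forall x, `|h x| <= M) -> `|mean h| <= M.
Proof.
move=> bh hM; rewrite ler_norml -{1}(mean_cst (- M)) -{2}(mean_cst M).
by rewrite !le_mean//; try exact: bm_cst; move=> x; have := hM x;
  rewrite ler_norml => /andP[].
Qed.

Lemma mean_bool (b : T -> bool) : measurable [set x | b x] ->
  mean (fun x => (b x)%:R) = fine (P [set x | b x]).
Proof.
move=> mb; rewrite /mean -[in RHS](setIT [set x | b x]).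
rewrite -(@integral_indic _ _ _ P setT measurableT _ mb).
congr fine; apply: eq_integral => x _; congr EFin.
by rewrite indicE; congr (nat_of_bool _)%:R; apply/idP/idP; rewrite inE.
Qed.

Lemma le_mean_ae (N : set T) h k : measurable N -> P N = 0%E ->
  bm h -> bm k -> (forall x, ~ N x -> h x <= k x) -> mean h <= mean k.
Proof.
move=> mN PN bh bk hk; rewrite -lee_fin !mean_EFin//.
have ih := bm_integrable Pfin bh; have ik := bm_integrable Pfin bk.
rewrite (negligible_integral mN _ ih)// (negligible_integral mN _ ik)//.
apply: le_integral => //; first exact: measurableD.
- by apply: integrableS ih => //; exact: measurableD.
- by apply: integrableS ik => //; exact: measurableD.
- by move=> x /set_mem[_ Nx]; rewrite /= lee_fin hk.
Qed.

End Mean.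

Lemma bm_integrable_prod {R : realType} {d1 d2} {T1 : measurableType d1}
    {T2 : measurableType d2} (P1 : probability T1 R) (P2 : probability T2 R)
    (h : T1 * T2 -> R) : bm h -> (P1 \x P2)%E.-integrable setT (EFin \o h).
Proof.
move=> bh; have P12 : ((P1 \x P2) (setT `*` setT) < +oo)%E.
  rewrite product_measure1E//.
  rewrite [X in (X * _)%E](@probability_setT _ _ _ P1) mul1e.
  by rewrite [X in (X < _)%E](@probability_setT _ _ _ P2) ltry.
by apply: bm_integrable bh; rewrite setXTT in P12.
Qed.

Lemma bm_mean {R : realType} {d1 d2} {T1 : measurableType d1}
    {T2 : measurableType d2} (P : probability T2 R) (h : T1 -> T2 -> R) :
  bm (fun t => h t.1 t.2) -> bm (fun x => mean P (h x)).
Proof.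
move=> bh; have [mh [M hM]] := bh; split; last first.
  exists M => x.
  by apply: mean_norm_le; [exact: bm_pair2 | move=> y; exact: (hM (x, y))].
(* The shift by [M] makes the integrand nonnegative, as the measurability part of Tonelli's theorem
   requires. *)
pose k (t : T1 * T2) := (h t.1 t.2 + M)%:E.
have mk : measurable_fun setT (fubini_F P k).
  apply: measurable_fun_fubini_tonelli_F => [|t].
    by apply/measurable_EFinP; exact: measurable_funD.
  by rewrite lee_fin; have := hM t; rewrite ler_norml; lra.
rewrite (_ : (fun x => _) = (fun x => fine (fubini_F P k x) - M)).
  by apply: measurable_funB => //; exact: measurableT_comp.
apply/funext => x; have bx := bm_pair2 x bh.
rewrite /fubini_F -(@mean_EFin _ _ _ P (fun y => h x y + M)); last first.
  by apply: bmD => //; exact: bm_cst.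
by rewrite /= meanD ?mean_cst//; [ring | exact: bm_cst].
Qed.

Section MeanProduct.
Context {R : realType} {d1 d2 : measure_display}.
Context {T1 : measurableType d1} {T2 : measurableType d2}.
Variables (P1 : probability T1 R) (P2 : probability T2 R).
Variable h : T1 -> T2 -> R.
Hypothesis bh : bm (fun t => h t.1 t.2).

Let ih : (P1 \x P2)%E.-integrable setT (EFin \o (fun t => h t.1 t.2)).
Proof.
exact: bm_integrable_prod.
Qed.

Let FE : (fun x => (mean P2 (h x))%:E) =
  fubini_F P2 (EFin \o (fun t => h t.1 t.2)).
Proof.
by apply/funext => x; rewrite mean_EFin//; exact: bm_pair2.
Qed.

Lemma integral_prod_mean :
  (\int[P1 \x P2]_t (h t.1 t.2)%:E)%E = (mean P1 (fun x => mean P2 (h x)))%:E.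
Proof.
rewrite mean_EFin; last exact: bm_mean.
by rewrite FE (integral12_prod_meas1 ih).
Qed.

End MeanProduct.

Lemma mean_fubini {R : realType} {d1 d2} {T1 : measurableType d1}
    {T2 : measurableType d2} (P1 : probability T1 R) (P2 : probability T2 R)
    (h : T1 -> T2 -> R) :
  bm (fun t => h t.1 t.2) ->
  mean P1 (fun x => mean P2 (h x)) = mean P2 (fun y => mean P1 (h^~ y)).
Proof.
move=> bh; have bh' := bm_swap bh; apply: EFin_inj.
rewrite -integral_prod_mean// (mean_EFin _ (@bm_mean _ _ _ _ _ P1 _ bh')).
have ih : (P1 \x P2)%E.-integrable setT (EFin \o (fun t => h t.1 t.2)).
  exact: bm_integrable_prod.
rewrite -(integral21_prod_meas1 ih); apply: eq_integral => y _.
by rewrite mean_EFin//; exact: (@bm_pair2 _ _ _ _ _ (fun y x => h x y)).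
Qed.

Ltac bm := first
  [ lazymatch goal with
    | |- bm (fun x => @GRing.mul _ (@?h x) (@?k x)) => apply: (@bmM _ _ _ h k); bm
    | |- bm (fun x => @Algebra.opp _ (@?h x)) => apply: (@bmN _ _ _ h); bm
    | |- bm (fun x => @Algebra.add _ (@?h x) (@?k x)) => apply: (@bmD _ _ _ h k); bm
    | |- bm (fun x => @Order.max _ _ (@?h x) (@?k x)) => apply: (@bm_max _ _ _ h k); bm
    | |- bm (fun x => @Order.min _ _ (@?h x) (@?k x)) => apply: (@bm_min _ _ _ h k); bm
    | |- bm (fun x => @Algebra.natmul _ _
        (nat_of_bool (@Order.lt _ _ (@?h x) (@?k x)))) =>
      apply: (@bm_lt _ _ _ h k); bm
    | |- bm (fun x => @Algebra.natmul _ _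
        (nat_of_bool (@Order.le _ _ (@?h x) (@?k x)))) =>
      apply: (@bm_le _ _ _ h k); bm
    | |- bm (fun _ => ?r) => exact: bm_cst
    end
  | assumption
  | apply: bm_fst; bm | apply: bm_snd; bm | apply: bm_swap; bm
  | apply: bm_mean; bm | apply: bm_pair2; bm ].

Lemma bm_monotone {R : realType} (h : measurableTypeR R -> R) M :
  {homo h : x y / x <= y} -> (forall x, `|h x| <= M) -> bm h.
Proof. by move=> hh hM; split; [exact: nondecreasing_measurable | exists M]. Qed.

(** * The law of a type *)

Section TypeLaw.
Context {R : realType}.
Variables (mu : probability (measurableTypeR R) R) (f : R -> R).
Hypothesis law : type_law mu f.

Let leb := @lebesgue_measure R.

Lemma law_set1 (a : R) : mu [set a] = 0%E.
Proof.
rewrite (densityP law)//; apply: integral_Sset1; exact: subIsetl.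
Qed.

Lemma law_out : mu (~` `[0, 1]%classic) = 0%E.
Proof.
rewrite (densityP law); last exact: measurableC.
by rewrite setICl integral_set0.
Qed.

Lemma law_in : mu `[0, 1]%classic = 1%E.
Proof.
have := probability_setC mu (measurable_itv `[0%R, 1%R]).
rewrite law_out -[X in (1 - X)%E](@fineK _ (mu _)) ?fin_num_measure//.
rewrite -EFinB => -[h]; rewrite -[LHS]fineK ?fin_num_measure//.
by apply/esym; congr EFin; apply/eqP; rewrite -subr_eq0 -h.
Qed.

Lemma density_integrable : leb.-integrable `[0, 1]%classic (EFin \o f).
Proof.
apply/integrableP; split; first by apply/measurable_EFinP; exact: density_measurable law.
under eq_integral => x.
  rewrite inE/= => x01; rewrite ger0_norm; last exact/ltW/(density_gt0 law).
  over.
have := densityP law (measurable_itv `[0%R, 1%R]).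
by rewrite setIid law_in => <-; rewrite ltry.
Qed.

(** A positive density with zero integral over an interval would make the interval Lebesgue-null,
    against its positive length. *)
Lemma law_gt0 (x y : R) : 0 <= x -> x < y -> y <= 1 -> (0 < mu `]x, y]%classic)%E.
Proof.
move=> x0 xy y1; rewrite lt0e measure_ge0 andbT; apply/negP => /eqP.
have sub : `]x, y]%classic `<=` `[0, 1]%classic.
  by move=> z /=; rewrite !in_itv/= => /andP[xz zy]; lra.
rewrite (densityP law)// setIidl// => int0.
have mf : measurable_fun `]x, y]%classic (EFin \o f).
  apply/measurable_EFinP; apply: measurable_funS (density_measurable law) => //.
have /(ae_eq_integral_abs leb (measurable_itv `]x, y]) mf) :
    (\int[leb]_(z in `]x, y]) `|(EFin \o f) z| = 0)%E.
  rewrite -int0; apply: eq_integral => z /set_mem/sub zi.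
  by rewrite /= ger0_norm// ltW// (density_gt0 law).
move=> f0; have : leb.-negligible `]x, y]%classic.
  apply: negligibleS f0 => z /= zi /(_ zi) [fz0].
  by have := density_gt0 law (sub z zi); rewrite fz0 ltxx.
move=> /(negligibleP leb (measurable_itv `]x, y])) leb0.
have := lebesgue_measure_itv `]x, y].
rewrite [X in X = _ -> _]leb0 /= lte_fin xy -EFinB => -[/eqP].
by rewrite eq_sym subr_eq0 => /eqP yx; rewrite yx ltxx in xy.
Qed.

Lemma F_ge0 x : 0 <= F mu x.
Proof. exact/fine_ge0/measure_ge0. Qed.

Lemma EFin_F x : (F mu x)%:E = mu `]-oo, x]%classic.
Proof. by rewrite fineK// fin_num_measure. Qed.

Lemma F_le1 x : F mu x <= 1.
Proof. by rewrite -lee_fin EFin_F probability_le1. Qed.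

Lemma F_homo : {homo F mu : x y / x <= y}.
Proof.
move=> x y xy; rewrite -lee_fin !EFin_F le_measure ?inE//.
by move=> z /=; rewrite !in_itv/= => /le_trans; exact.
Qed.

Lemma F_lt (x y : R) : 0 <= x -> x < y -> y <= 1 -> F mu x < F mu y.
Proof.
move=> x0 xy y1; rewrite -lte_fin !EFin_F.
have -> : `]-oo, y]%classic = `]-oo, x]%classic `|` `]x, y]%classic.
  by rewrite -itv_bndbnd_setU// bnd_simp ltW.
rewrite measureU//; last first.
  rewrite -subset0 => z [] /=; rewrite !in_itv/= => ? /andP[? ?]; lra.
by rewrite lteDl ?law_gt0// fin_num_measure.
Qed.

Lemma F_le0 x : x <= 0 -> F mu x = 0.
Proof.
move=> x0; apply/le_anti; rewrite F_ge0 andbT.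
rewrite -lee_fin EFin_F.
apply: (@le_trans _ _ (mu (~` `[0%R, 1%R]%classic `|` [set 0%R]))).
  apply: le_measure; rewrite ?inE//.
    by apply: measurableU => //; exact: measurableC.
  move=> z /=; rewrite !in_itv/= => zx.
  have [->|z0] := eqVneq z 0; [by right|left].
  move=> /andP[z1 _]; case/negP: z0.
  by rewrite eq_le z1 (le_trans zx).
rewrite (le_trans (measureU2 _ _ _))//; first exact: measurableC.
by rewrite [X in (X + _)%E]law_out [X in (_ + X)%E]law_set1 adde0.
Qed.

Lemma F_ge1 x : 1 <= x -> F mu x = 1.
Proof.
move=> x1; apply/le_anti; rewrite F_le1/=.
rewrite -lee_fin EFin_F -law_in le_measure ?inE//.
by move=> z /=; rewrite !in_itv/= => /andP[_ /le_trans]; apply.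
Qed.

Lemma F_integral x : 0 <= x -> x <= 1 ->
  F mu x = parameterized_integral leb 0 x f.
Proof.
move=> x0 x1; rewrite /F /parameterized_integral /Rintegral (densityP law)//.
congr fine; congr (integral _ _ _).
apply/seteqP; split => z /=; rewrite !in_itv/=.
  by move=> [zx /andP[-> _]].
by move=> /andP[-> zx]; rewrite zx (le_trans zx).
Qed.

Lemma F_continuous : {within `[0, 1], continuous (F mu)}.
Proof.
have := parameterized_integral_continuous (ler01 : (0 <= 1 :> R)) density_integrable.
apply: subspace_eq_continuous => x; rewrite inE/= in_itv/= => /andP[x0 x1].
exact/esym/F_integral.
Qed.

Lemma F_surj p : 0 <= p -> p <= 1 -> exists t, [/\ 0 <= t, t <= 1 & F mu t = p].
Proof.
move=> p0 p1; have [|t] := IVT ler01 F_continuous (v := p).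
  by rewrite F_le0// F_ge1// minElt maxElt ltr01 p0 p1.
by rewrite in_itv/= => /andP[t0 t1] Ft; exists t.
Qed.

(** The law has no atoms, so one type [a] may be exempted: at a cutoff, strict and weak comparisons
    then become interchangeable. *)
Lemma le_mean01 (a : R) (h k : R -> R) : bm h -> bm k ->
  (forall x, 0 <= x -> x <= 1 -> x != a -> h x <= k x) ->
  mean mu h <= mean mu k.
Proof.
move=> bh bk hk.
have mN : measurable (~` `[0%R, 1%R] `|` [set a] : set (measurableTypeR R)).
  by apply: measurableU => //; exact: measurableC.
apply: (le_mean_ae mN) => // [|x /not_orP[/contrapT/= + /eqP xa]].
  apply/eqP; rewrite -measure_le0 (le_trans (measureU2 _ _ _))//.
    exact: measurableC.
  by rewrite [X in (X + _)%E]law_out [X in (_ + X)%E]law_set1 adde0.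
by rewrite in_itv/= => /andP[x0 x1]; exact: hk.
Qed.

Lemma eq_mean01 (a : R) (h k : R -> R) : bm h -> bm k ->
  (forall x, 0 <= x -> x <= 1 -> x != a -> h x = k x) ->
  mean mu h = mean mu k.
Proof.
move=> bh bk hk; apply/le_anti/andP; split;
  by apply: (@le_mean01 a) => // x *; rewrite hk.
Qed.

Lemma bm_F : bm (F mu : measurableTypeR R -> R).
Proof.
apply: (@bm_monotone _ _ 1) => [|x]; first exact: F_homo.
by rewrite ger0_norm ?F_ge0 ?F_le1.
Qed.

Lemma bm_gt (t : R) : bm (fun x : measurableTypeR R => (t < x)%R%:R : R).
Proof.
apply: (@bm_monotone _ _ 1) => [x y xy|x].
  by case: ltP => // tx; rewrite (lt_le_trans tx xy).
by case: ltP => _; rewrite ?normr0 ?normr1.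
Qed.

Lemma mean_gt (t : R) : mean mu (fun x => (t < x)%R%:R) = 1 - F mu t.
Proof.
have mt : measurable (`]t, +oo[%classic : set (measurableTypeR R)) by [].
have E : [set x | (t < x)%R] = `]t, +oo[%classic :> set (measurableTypeR R).
  by apply/seteqP; split => x /=; rewrite in_itv/= andbT.
rewrite mean_bool E//.
have := probability_setC mu (measurable_itv `]-oo, t]).
rewrite setCitvl -EFin_F -EFinB /F => -> //.
Qed.

(** The probability integral transform: [F] of a random type is uniform on [0, 1]. Strict
    monotonicity of [F] identifies the event with [x < t], where [F t = a]. *)
Lemma mean_F_lt (a : R) : 0 <= a -> a <= 1 ->
  mean mu (fun x => (F mu x < a)%R%:R) = a.
Proof.
move=> a0 a1; have [t [t0 t1 <-]] := F_surj a0 a1.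
transitivity (mean mu (fun x => 1 - (t < x)%R%:R)).
  apply: (@eq_mean01 t) => [||x x0 x1 xt]; first exact: bm_lt bm_F (bm_cst _).
    exact: bmB (bm_cst _) (bm_gt t).
  have [xt'|tx|xt'] := ltgtP x t; last by rewrite xt' eqxx in xt.
    by rewrite F_lt// subr0.
  by rewrite ltNge F_homo ?ltW//= subrr.
by rewrite meanB ?mean_cst ?mean_gt; [ring|exact: bm_cst|exact: bm_gt].
Qed.

Lemma mean_F_le (a : R) : 0 <= a -> a <= 1 ->
  mean mu (fun x => (F mu x <= a)%R%:R) = a.
Proof.
move=> a0 a1; have [t [t0 t1 Ft]] := F_surj a0 a1.
rewrite -[RHS]mean_F_lt//; apply: (@eq_mean01 t) => [||x x0 x1 xt].
- exact: bm_le bm_F (bm_cst _).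
- exact: bm_lt bm_F (bm_cst _).
rewrite -Ft; have [xt'|tx|xt'] := ltgtP x t; last by rewrite xt' eqxx in xt.
  by rewrite F_lt// F_homo// ltW.
have FtFx : F mu t < F mu x by exact: F_lt.
by rewrite leNgt FtFx ltNge (ltW FtFx).
Qed.

End TypeLaw.

(** * The investment cost and its convex conjugate *)

Section Cost.
Context {R : realType}.
Variables g g' : R -> R.
Hypothesis cost : investment_cost g g'.

Lemma g'_lt_pos (x y : R) : 0 < x -> x < y -> g' x < g' y.
Proof.
move=> x0 xy.
have D z : x <= z -> derivable g' z 1 by move=> xz; apply: (g'_derivable cost); lra.
apply: (@gtr0_derive1_incr _ g' x y) => //.
- by move=> z; rewrite in_itv/= => /andP[/ltW/D].
- by move=> z; rewrite in_itv/= => /andP[xz _]; apply: (g''_gt0 cost); lra.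
- apply: derivable_within_continuous => z; rewrite in_itv/= => /andP[xz _]; exact: D.
Qed.

Lemma g'_lt (x y : R) : 0 <= x -> x < y -> g' x < g' y.
Proof.
rewrite le_eqVlt => /predU1P[<-|]; last exact: g'_lt_pos.
by rewrite (g'_at0 cost); exact: (g'_gt0 cost).
Qed.

Lemma g'_le (x y : R) : 0 <= x -> x <= y -> g' x <= g' y.
Proof.
move=> x0; rewrite le_eqVlt => /predU1P[<-//|xy]; exact/ltW/g'_lt.
Qed.

Lemma g_continuous_pos (x : R) : 0 < x -> {for x, continuous g}.
Proof.
move=> x0; apply: differentiable_continuous; apply/derivable1_diffP.
by have := g_deriv cost x0; case.
Qed.

Lemma g_continuous_at0 : g h @[h --> 0^'+] --> g 0.
Proof.
have h0 : h @[h --> (0 : R)^'+] --> (0 : R) by exact: cvg_within.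
have := cvgM h0 (g_rderiv0 cost); rewrite mul0r => gc.
rewrite (g_at0 cost).
apply: (cvg_trans _ (gc _)); apply: near_eq_cvg => /=.
near=> h.
by rewrite (g_at0 cost) subr0 mulrA divff ?mul1r// gt_eqF//; near: h;
  exact: nbhs_right_gt.
Unshelve. all: by end_near. Qed.

Lemma g_LR (b : R) : 0 < b -> derivable_oo_LRcontinuous g 0 b.
Proof.
move=> b0; split.
- by move=> x; rewrite in_itv/= => /andP[x0 _]; have := g_deriv cost x0; case.
- exact: g_continuous_at0.
- exact/cvg_at_left_filter/g_continuous_pos.
Qed.

(** At 0 only a right derivative of [g] is given. The mean value theorem turns a small difference
    quotient over [0, h] into a small value [g' c] with [0 < c], and monotonicity bounds [g'] by it
    on ]0, c[. *)
Lemma g'_continuous_at0 : g' h @[h --> 0^'+] --> g' 0.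
Proof.
rewrite (g'_at0 cost); apply/cvgrPdist_lt => e e0.
have := g_rderiv0 cost; rewrite (g'_at0 cost) => /cvgrPdist_lt/(_ e e0) H.
have [h [h0 he]] : exists h : R, 0 < h /\ `|0 - h^-1 * (g h - g 0)| < e.
  by near (0 : R)^'+ => h; exists h; split; [|near: h].
have [c] := MVT h0 (fun x xi => g_deriv cost (andP xi).1)
  (derivable_oo_LRcontinuous_within (g_LR h0)).
rewrite in_itv/= subr0 => /andP[c0 ch] Dc.
have gce : g' c < e.
  move: he; rewrite Dc mulrCA mulVf ?gt_eqF// mulr1 sub0r normrN gtr0_norm//.
  exact: (g'_gt0 cost).
near=> x; have x0 : 0 < x by near: x; exact: nbhs_right_gt.
rewrite sub0r normrN gtr0_norm; last exact: (g'_gt0 cost).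
apply: lt_trans gce; apply: g'_lt_pos => //; near: x; exact: nbhs_right_lt.
Unshelve. all: by end_near. Qed.

Lemma g'_continuous (b : R) : 0 < b -> {within `[0, b], continuous g'}.
Proof.
move=> b0; apply: derivable_oo_LRcontinuous_within; split.
- by move=> x; rewrite in_itv/= => /andP[x0 _]; exact: (g'_derivable cost).
- exact: g'_continuous_at0.
- apply: cvg_at_left_filter; apply: differentiable_continuous.
  by apply/derivable1_diffP; exact: (g'_derivable cost).
Qed.

(** The marginal benefit of quality is a winning probability, at most 1; the point [Q] where the
    marginal cost reaches 1 therefore bounds all useful qualities. *)
Lemma g'_reach1 : exists2 Q, 0 < Q & g' Q = 1.
Proof.
have [q [q0 q1]] : exists q : R, 0 < q /\ 1 < g' q.
  near (+oo : set_system R) => q; exists q; split; near: q.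
    exact: nbhs_pinfty_gt.
  exact: g'_large cost.
have [|Q] := IVT (ltW q0) (g'_continuous q0) (v := 1).
  by rewrite (g'_at0 cost) minEle maxEle (ltW (g'_gt0 cost q0)) ler01 ltW.
rewrite in_itv/= => /andP[Q0 _] Q1; exists Q => //.
rewrite lt_neqAle Q0 andbT; apply/negP => /eqP Q00.
by move: Q1; rewrite -Q00 (g'_at0 cost) => /eqP; rewrite eq_sym oner_eq0.
Unshelve. all: by end_near. Qed.

Lemma g'_surj Q (x : R) : 0 < Q -> g' Q = 1 -> 0 <= x -> x <= 1 ->
  exists q, [/\ 0 <= q, q <= Q & g' q = x].
Proof.
move=> Q0 Q1 x0 x1.
have [|q] := IVT (ltW Q0) (g'_continuous Q0) (v := x).
  by rewrite (g'_at0 cost) Q1 minEle maxEle ler01 x0.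
by rewrite in_itv/= => /andP[q0 qQ] gq; exists q.
Qed.

Lemma g_integral (q : R) : 0 <= q ->
  (\int[lebesgue_measure]_(x in `[0%R, q]) (g' x)%:E = (g q)%:E)%E.
Proof.
rewrite le_eqVlt => /predU1P[<-|q0].
  by rewrite set_itv1 integral_set1 (g_at0 cost).
rewrite (continuous_FTC2 q0 (g'_continuous q0) (g_LR q0)).
  by rewrite (g_at0 cost) sube0.
move=> x; rewrite in_itv/= => /andP[x0 _]; rewrite derive1E.
by have D := g_deriv cost x0; rewrite derive_val.
Qed.

Lemma g_steep (Q q : R) : 0 < Q -> g' Q = 1 -> Q <= q -> q - Q <= g q - g Q.
Proof.
move=> Q0 Q1; rewrite le_eqVlt => /predU1P[<-|Qq]; first by rewrite !subrr.
have Qg x : x \in `]Q, q[ -> is_derive x 1 g (g' x).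
  by rewrite in_itv/= => /andP[Qx _]; apply: (g_deriv cost); exact: lt_trans Qx.
have cg : {within `[Q, q], continuous g}.
  apply: derivable_within_continuous => x; rewrite in_itv/= => /andP[Qx _].
  by have := g_deriv cost (lt_le_trans Q0 Qx); case.
have [c + ->] := MVT Qq Qg cg; rewrite in_itv/= => /andP[Qc cq].
by rewrite ler_peMl ?subr_ge0 ?(ltW Qq)// -Q1 ltW// g'_lt_pos.
Qed.

Lemma g_le (x y : R) : 0 <= x -> x <= y -> g x <= g y.
Proof.
move=> x0; rewrite le_eqVlt => /predU1P[->//|xy].
have gd z : z \in `]x, y[ -> is_derive z 1 g (g' z).
  by rewrite in_itv/= => /andP[xz _]; apply: (g_deriv cost); lra.
have cg : {within `[x, y], continuous g}.
  apply: continuous_subspaceW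
    (derivable_oo_LRcontinuous_within (g_LR (le_lt_trans x0 xy))).
  by move=> z /=; rewrite !in_itv/= => /andP[xz ->]; rewrite (le_trans x0 xz).
have [z + E] := MVT xy gd cg; rewrite in_itv/= => /andP[xz _].
rewrite -subr_ge0 E mulr_ge0 ?subr_ge0 ?(ltW xy)//.
by apply/ltW/(g'_gt0 cost); exact: le_lt_trans xz.
Qed.

Lemma measurable_g (d : measure_display) (T : measurableType d) (q : T -> R) :
  measurable_fun setT q -> (forall x, 0 <= q x) ->
  measurable_fun setT (fun x => g (q x)).
Proof.
(* [g] is controlled only on nonnegative qualities; extended to the left by [g 0] it is monotone on
   the whole line, hence measurable. *)
move=> mq q0; pose G (x : R) := g (Num.max x 0).
have mG : measurable_fun setT G.
  apply: nondecreasing_measurable => // x y xy.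
  apply: g_le; first by rewrite le_max lexx orbT.
  by rewrite ge_max !le_max xy lexx !orbT.
rewrite (_ : (fun x => _) = G \o q); first exact: measurableT_comp.
by apply/funext => x; rewrite /G /= max_l.
Qed.

Variables (Q : R) (Q0 : 0 < Q).

Lemma bm_g (d : measure_display) (T : measurableType d) (q : T -> R) :
  bm q -> (forall x, 0 <= q x <= Q) -> bm (fun x => g (q x)).
Proof.
move=> [mq _] q01; split.
  by apply: measurable_g => // x; have /andP[] := q01 x.
exists (g Q) => x; have /andP[h0 h1] := q01 x.
by rewrite ger0_norm ?g_le// -(g_at0 cost) g_le.
Qed.

Hypothesis Q1 : g' Q = 1.

(** Projecting onto [0, [Q]] first gives a monotone function with values in [0, 1] on the whole
    line, where [g'] itself is unconstrained. *)
Definition marg (r : R) : R := g' (Num.min (Num.max r 0) Q).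

Let clampQ (r : R) : 0 <= Num.min (Num.max r 0) Q.
Proof. by rewrite le_min le_max lexx orbT ltW. Qed.

Lemma marg_id (r : R) : 0 <= r -> r <= Q -> marg r = g' r.
Proof. by move=> r0 rQ; rewrite /marg max_l// min_l. Qed.

Lemma marg_ge0 r : 0 <= marg r.
Proof. by rewrite -(g'_at0 cost) g'_le. Qed.

Lemma marg_le1 r : marg r <= 1.
Proof. by rewrite -Q1 g'_le// ge_min lexx orbT. Qed.

Lemma marg_homo : {homo marg : x y / x <= y}.
Proof.
move=> x y xy; apply: g'_le => //; rewrite le_min !ge_min lexx orbT andbT.
by rewrite ge_max !le_max xy lexx !orbT.
Qed.

Lemma bm_marg : bm (marg : measurableTypeR R -> R).
Proof.
apply: (@bm_monotone _ _ 1) => [|x]; first exact: marg_homo.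
by rewrite ger0_norm ?marg_ge0 ?marg_le1.
Qed.

(** Integrals over quality levels are written as [Q] times a mean under this law, so that
    [mean_fubini] also exchanges types and quality levels. *)
Definition uni : probability (measurableTypeR R) R := uniform_prob Q0.

Lemma mean_uni (h : R -> R) : bm (h : measurableTypeR R -> R) ->
  (forall x, 0 <= h x) ->
  ((Q * mean uni h)%:E = \int[lebesgue_measure]_(x in `[0%R, Q]) (h x)%:E)%E.
Proof.
move=> bh h0; rewrite EFinM mean_EFin// integral_uniform//.
- by rewrite subr0 muleA -EFinM divff ?gt_eqF// mul1e.
- by case: bh => + _; move/measurable_EFinP.
Qed.

Lemma bm_ltq (q : R) : bm (fun r : measurableTypeR R => (r < q)%R%:R : R).
Proof.
have -> : (fun r : measurableTypeR R => (r < q)%R%:R : R) =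
    (fun r => 1 - (q <= r)%R%:R).
  by apply/funext => r; case: ltP => _; rewrite ?subr0 ?subrr.
apply: bmB; first exact: bm_cst.
apply: (@bm_monotone _ _ 1) => [x y xy|x].
  by rewrite ler_nat; case: (leP q x) => // qx; rewrite (le_trans qx xy).
by case: (q <= x)%R; rewrite ?normr0 ?normr1.
Qed.

Lemma mean_uni_lt q : 0 <= q -> q <= Q ->
  Q * mean uni (fun r => (r < q)%R%:R) = q.
Proof.
move=> q0 qQ; apply: EFin_inj; rewrite mean_uni; [|exact: bm_ltq|by []].
transitivity (\int[lebesgue_measure]_(x in `[0%R, Q]) (\1_`[0%R, q[ x)%:E)%E.
  apply: eq_integral => r; rewrite inE/= in_itv/= => /andP[r0 rQ].
  by rewrite indicE mem_setE in_itv/= r0.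
rewrite integral_indic// setIidl.
  rewrite [LHS](lebesgue_measure_itv `[0%R, q[)/= lte_fin sube0.
  by case: ltgtP q0 => // <-.
by move=> r /=; rewrite !in_itv/= => /andP[-> /ltW/le_trans]; apply.
Qed.

Lemma mean_uni_marg q : 0 <= q -> q <= Q ->
  Q * mean uni (fun r => (r < q)%R%:R * marg r) = g q.
Proof.
move=> q0 qQ; apply: EFin_inj; rewrite mean_uni; first last.
- by move=> r; rewrite mulr_ge0// marg_ge0.
- exact: bmM (bm_ltq q) bm_marg.
have mg : measurable_fun `[0%R, q[%classic (EFin \o g' : R -> \bar R).
  apply/measurable_EFinP.
  apply: (@eq_measurable_fun _ _ _ _ _ marg).
    move=> r; rewrite inE/= in_itv/= => /andP[r0 rq].
    by rewrite marg_id// (le_trans (ltW rq)).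
  by apply: measurable_funTS; case: bm_marg.
rewrite -(g_integral q0) -(integral_itv_bndo_bndc mg).
rewrite [RHS]integral_mkcond [LHS]integral_mkcond; apply: eq_integral => r _.
rewrite !patchE !mem_setE !in_itv/=.
have [r0|] := leP 0 r => //=; have [rQ|Qr] := leP r Q => /=.
  by case: ltP => rq; rewrite ?mul1r ?mul0r// marg_id.
by case: ltP => // /(lt_trans Qr); rewrite ltNge qQ.
Qed.

(* The conjugate [sup_q (x q - g q)] of [g] is the integral over [0, Q] of the
   positive part of [x - g']; its derivative [conjugate_arg] is the maximizer. *)
Definition conjugate x := Q * mean uni (fun r => Num.max (x - marg r) 0).

Definition conjugate_arg y := Q * mean uni (fun r => (marg r < y)%R%:R).

(** Layer-cake form: both [q] and [g q] are integrals over the quality levels [r < q], of 1 and of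
    the marginal cost. *)
Lemma conj_affine x q : 0 <= q -> q <= Q ->
  x * q - g q = Q * mean uni (fun r => (r < q)%R%:R * (x - marg r)).
Proof.
move=> q0 qQ; have b1 := bm_ltq q; have b2 := bm_marg.
rewrite -(mean_uni_marg q0 qQ) -[X in x * X - _](mean_uni_lt q0 qQ).
rewrite mulrCA -mulrBr -[x * mean _ _]meanZ// -meanB; [|bm|bm].
by congr (Q * _); apply: mean_ext => r; rewrite mulrBr [in RHS]mulrC.
Qed.

Lemma young x q : 0 <= q -> q <= Q -> x * q - g q <= conjugate x.
Proof.
move=> q0 qQ; rewrite conj_affine// ler_pM2l//.
have b1 := bm_ltq q; have b2 := bm_marg.
apply: le_mean; [bm|bm|] => r.
by case: (r < q)%R; rewrite ?mul1r ?mul0r le_max lexx ?orbT.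
Qed.

(** By monotonicity of [marg], the layer-cake integrand at [x = g' q] is nonnegative below [q] and
    nonpositive above, so cutting at [q] is the same as taking the positive part. *)
Lemma young_eq q : 0 <= q -> q <= Q -> conjugate (g' q) = g' q * q - g q.
Proof.
move=> q0 qQ; rewrite conj_affine//; congr (Q * _).
apply: mean_ext => r; rewrite -(marg_id q0 qQ).
case: ltP => [rq|qr]; rewrite ?mul1r ?mul0r.
  by rewrite max_l// subr_ge0 marg_homo// ltW.
by rewrite max_r// subr_le0 marg_homo.
Qed.

Lemma conjugate_arg_g' q : 0 <= q -> q <= Q -> conjugate_arg (g' q) = q.
Proof.
move=> q0 qQ; rewrite -[RHS](mean_uni_lt q0 qQ).
have b1 := bm_ltq q; have b2 := bm_marg.
apply: EFin_inj; rewrite !mean_uni//; [|bm].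
apply: eq_integral => r; rewrite inE/= in_itv/= => /andP[r0 rQ].
rewrite marg_id//; congr (((nat_of_bool _)%:R)%:E).
by apply/idP/idP; [apply: contraTT; rewrite -!leNgt; exact: g'_le | exact: g'_lt].
Qed.

End Cost.

(** * Reduced forms *)

Section Contest.
Context {R : realType}.
Variables (mu : probability (measurableTypeR R) R) (f : R -> R).
Hypothesis law : type_law mu f.
Variables (g g' : R -> R) (Q : R).
Hypotheses (cost : investment_cost g g') (Q0 : 0 < Q) (Q1 : g' Q = 1).

Definition surv (x : R) := 1 - F mu x.

(** This is [q_sym] (see [q_symE]) written as an integral over quality levels, which gives
    measurability and lets Fubini match it with the layer-cake form of the conjugate. *)
Definition phi (x : R) := conjugate_arg g' Q0 (surv x).

(* If firm 2 wins with probability [B x] at type [x] and firm 1 now wins exactly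
   when [B x <= surv y], then firm 1 of type [y] wins with probability [dag B y]
   while [B] is unchanged: [dag] is the generalized inverse of a reduced form. *)
Definition dag (B : R -> R) (y : R) := mean mu (fun x => (B x <= surv y)%R%:R).

Lemma bm_surv : bm (surv : measurableTypeR R -> R).
Proof. by have bF := bm_F mu; rewrite /surv; bm. Qed.

Lemma surv01 x : 0 <= surv x <= 1.
Proof. by rewrite subr_ge0 F_le1// gerBl F_ge0. Qed.

Lemma surv_homo x y : x <= y -> surv y <= surv x.
Proof. by move=> xy; rewrite lerB// F_homo. Qed.

Let bm_p := bm_marg cost Q0 Q1.
Let bm_s := bm_surv.

Lemma bm_phi : bm (phi : measurableTypeR R -> R).
Proof.
apply: bmM; first exact: bm_cst.
bm.
Qed.

Lemma phiP x : [/\ 0 <= phi x, phi x <= Q & g' (phi x) = surv x].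
Proof.
have /andP[h0 h1] := surv01 x.
have [q [q0 qQ gq]] := g'_surj cost Q0 Q1 h0 h1.
by rewrite /phi -gq (conjugate_arg_g' cost Q0 Q1).
Qed.

Lemma q_symE x : q_sym mu g' x = phi x.
Proof.
have [q0 qQ gq] := phiP x; rewrite /q_sym -/(surv x) -gq pinvKV//; last first.
  by rewrite inE/= in_itv/= q0.
move=> y z; rewrite !inE/= !in_itv/= !andbT => y0 z0 gyz.
by have [yz|zy|//] := ltgtP y z; [have := g'_lt cost y0 yz|have := g'_lt cost z0 zy];
  rewrite gyz ltxx.
Qed.

Lemma bm_dag (B : R -> R) : bm (B : measurableTypeR R -> R) ->
  bm (dag B : measurableTypeR R -> R).
Proof. by move=> bB; bm. Qed.

Lemma mean_surv_lt x : 0 <= x -> x <= 1 ->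
  mean mu (fun t => (surv t < x)%R%:R) = x.
Proof.
move=> x0 x1; have bF := bm_F mu.
rewrite (_ : (fun t => _) = (fun t => 1 - (F mu t <= 1 - x)%R%:R)); last first.
  apply/funext => t; rewrite /surv ltrBlDr addrC -ltrBlDr ltNge.
  by case: (F mu t <= 1 - x)%R; rewrite ?subr0 ?subrr.
rewrite meanB ?mean_cst ?(mean_F_le law); [ring|lra|lra|bm|bm].
Qed.

Lemma mean_surv_ge x : 0 <= x -> x <= 1 ->
  mean mu (fun t => (x <= surv t)%R%:R) = 1 - x.
Proof.
move=> x0 x1; have bF := bm_F mu.
rewrite (_ : (fun t => _) = (fun t => (F mu t <= 1 - x)%R%:R)).
  by rewrite (mean_F_le law)//; lra.
by apply/funext => t; congr ((nat_of_bool _)%:R); apply/idP/idP; rewrite /surv; lra.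
Qed.

Lemma mean_surv_gt x : 0 <= x -> x <= 1 ->
  mean mu (fun t => (x < surv t)%R%:R) = 1 - x.
Proof.
move=> x0 x1; have bF := bm_F mu.
rewrite (_ : (fun t => _) = (fun t => (F mu t < 1 - x)%R%:R)).
  by rewrite (mean_F_lt law)//; lra.
by apply/funext => t; congr ((nat_of_bool _)%:R); apply/idP/idP; rewrite /surv; lra.
Qed.

(** Since [surv] of a type is uniform, this mean is the length of ]p, x[; it trades the positive
    part in the conjugate for an integral over types. *)
Lemma mean_surv_between p x : 0 <= p -> p <= 1 -> 0 <= x -> x <= 1 ->
  mean mu (fun t => (p < surv t)%R%:R * (surv t < x)%R%:R) = Num.max (x - p) 0.
Proof.
move=> p0 p1 x0 x1; have [xp|px] := leP x p.
  rewrite max_r ?subr_le0//.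
  rewrite (_ : (fun t => _) = (fun=> 0)) ?mean_cst//; apply/funext => t.
  by case: ltP => //= pt; rewrite ?mul0r// ltNge (ltW (le_lt_trans xp pt)) mulr0.
rewrite max_l ?subr_ge0 ?ltW//.
rewrite (_ : (fun t => _) =
    (fun t => (p < surv t)%R%:R - (1 - (surv t < x)%R%:R))).
  rewrite !meanB ?mean_cst ?mean_surv_gt ?mean_surv_lt//; try bm; lra.
apply/funext => t; case: (ltP p) => pt; last first.
  by rewrite (le_lt_trans pt px) mul0r subrr subr0.
by rewrite mul1r; case: ltP => _; rewrite ?subrr ?subr0 ?subrr.
Qed.

Lemma bm_conj (Z : R -> R) : bm (Z : measurableTypeR R -> R) ->
  bm (fun x : measurableTypeR R => conjugate g' Q0 (Z x)).
Proof.
move=> bZ; apply: bmM; first exact: bm_cst.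
bm.
Qed.

Lemma mean_conj (Z : R -> R) : bm (Z : measurableTypeR R -> R) ->
  mean mu (fun x => conjugate g' Q0 (Z x)) =
  Q * mean (uni Q0) (fun r => mean mu (fun x => Num.max (Z x - marg g' Q r) 0)).
Proof.
move=> bZ; rewrite meanZ; last by bm.
by rewrite mean_fubini//; bm.
Qed.

(** The conjugate is the integral of its derivative [conjugate_arg] over [0, x]; the change of
    variable through the uniform variable [surv t] turns that derivative into [phi t]. *)
Lemma conj_phi x : 0 <= x -> x <= 1 ->
  conjugate g' Q0 x = mean mu (fun t => phi t * (surv t < x)%R%:R).
Proof.
move=> x0 x1.
transitivity (mean mu (fun t => Q * mean (uni Q0) (fun r =>
    (marg g' Q r < surv t)%R%:R * (surv t < x)%R%:R))).
  rewrite meanZ; last by bm.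
  rewrite mean_fubini; last by bm.
  congr (Q * _); apply: mean_ext => r.
  by rewrite mean_surv_between// ?(marg_ge0 cost)// ?(marg_le1 cost).
apply: mean_ext => t; rewrite meanZr; last by bm.
by rewrite mulrA.
Qed.

(** By [conj_phi] and Fubini, [phi t] is collected from the types [x] with [surv t < Z x], whose
    mass is [1 - dag Z t]. A convex functional of [Z] thus becomes linear in [dag Z]. *)
Lemma mean_conj_dag (Z : R -> R) : bm (Z : measurableTypeR R -> R) ->
  (forall x, 0 <= Z x <= 1) ->
  mean mu (fun x => conjugate g' Q0 (Z x)) = mean mu (fun t => phi t * (1 - dag Z t)).
Proof.
move=> bZ Z01; have bp := bm_phi.
transitivity (mean mu (fun x => mean mu (fun t => phi t * (surv t < Z x)%R%:R))).
  by apply: mean_ext => x; have /andP[z0 z1] := Z01 x; rewrite conj_phi.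
rewrite mean_fubini; last by bm.
apply: mean_ext => t; rewrite meanZ; last by bm.
congr (_ * _); rewrite -[X in X - _](mean_cst mu) -meanB; [|bm|bm].
by apply: mean_ext => x; case: ltP => _; rewrite ?subr0 ?subrr.
Qed.

Definition bm2 (w : R -> R -> R) :=
  bm (fun t : measurableTypeR R * measurableTypeR R => w t.1 t.2).

(* [w x y] is the probability that firm 1 wins at the type profile [(x, y)]. *)
Definition reduced1 (w : R -> R -> R) (x : R) := mean mu (w x).
Definition reduced2 (w : R -> R -> R) (y : R) := mean mu (fun x => 1 - w x y).

Lemma bm2_left w y : bm2 w -> bm (w^~ y : measurableTypeR R -> R).
Proof.
by move=> bw; exact: (@bm_pair2 _ _ _ _ _ (fun y x => w x y)) (bm_swap bw).
Qed.

Lemma bm2_right w x : bm2 w -> bm (w x : measurableTypeR R -> R).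
Proof. by move=> bw; exact: bm_pair2. Qed.

Lemma bm_reduced1 w : bm2 w -> bm (reduced1 w : measurableTypeR R -> R).
Proof. by move=> bw; exact: (@bm_mean _ _ _ _ _ mu). Qed.

Lemma bm_reduced2 w : bm2 w -> bm (reduced2 w : measurableTypeR R -> R).
Proof.
move=> bw; apply: (@bm_mean _ _ _ _ _ mu (fun y x => 1 - w x y)).
by apply: bmB; [bm | exact: bm_swap bw].
Qed.

Lemma unit_mean (h : R -> R) : bm (h : measurableTypeR R -> R) ->
  (forall x, 0 <= h x <= 1) -> 0 <= mean mu h <= 1.
Proof.
move=> bh h01; apply/andP; split.
  rewrite -[leLHS](mean_cst mu); apply: le_mean; [bm|bm|] => x.
  by have /andP[] := h01 x.
rewrite -[leRHS](mean_cst mu); apply: le_mean; [bm|bm|] => x.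
by have /andP[] := h01 x.
Qed.

(** * Shifting victories toward low types of firm 1 *)

Section Bathtub.
Variable w : R -> R -> R.
Hypotheses (bw : bm2 w)
  (w01 : forall x y, 0 <= w x y <= 1).

Local Notation A := (reduced1 w).
Local Notation B := (reduced2 w).

Let bmA : bm (A : measurableTypeR R -> R) := bm_reduced1 bw.
Let bmB' : bm (B : measurableTypeR R -> R) := bm_reduced2 bw.

Let meanw y : mean mu (w^~ y) = 1 - B y.
Proof.
rewrite /reduced2 meanB ?mean_cst; [ring|bm|exact: bm2_left].
Qed.

Let B01 y : 0 <= B y <= 1.
Proof.
apply: unit_mean; first by apply: bmB; [bm|exact: bm2_left].
by move=> x; have := w01 x y; lra.
Qed.

(* For each type [y] of firm 2, the mass [1 - B y] that [w] gives to firm 1 is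
   best spent on the lowest types of firm 1. *)
Lemma bathtub (c : R -> R) : bm (c : measurableTypeR R -> R) ->
  (forall x y, x <= y -> c y <= c x) ->
  mean mu (fun x => c x * A x) <= mean mu (fun x => c x * dag B x).
Proof.
move=> bc cle.
rewrite (_ : (fun x => c x * A x) =
    (fun x => mean mu (fun y => c x * w x y))); last first.
  by apply/funext => x; rewrite meanZ//; exact: bm_pair2.
rewrite (_ : (fun x => c x * dag B x) =
    (fun x => mean mu (fun y => c x * (B y <= surv x)%R%:R))); last first.
  by apply/funext => x; rewrite meanZ//; bm.
rewrite [leLHS]mean_fubini; last by bm.
rewrite [leRHS]mean_fubini; last by bm.
have bcw : bm (fun t : measurableTypeR R * measurableTypeR R => c t.2 * w t.2 t.1).
  by apply: bmM; [bm | exact: bm_swap bw].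
apply: le_mean => [||y].
- exact: (@bm_mean _ _ _ _ _ mu (fun y x => c x * w x y)).
- by apply: (@bm_mean _ _ _ _ _ mu (fun y x => c x * (B y <= surv x)%R%:R)); bm.
have /andP[b0 b1] := B01 y; have bwy := bm2_left y bw.
have Fb0 : 0 <= 1 - B y by lra.
have Fb1 : 1 - B y <= 1 by lra.
have [t [t0 t1 Ft]] := F_surj law Fb0 Fb1.
have sB : B y = surv t by rewrite /surv; lra.
rewrite -subr_le0 -meanB; [|bm|bm].
(* Both allocations give firm 1 the mass [1 - B y] against type [y], so weighting their difference
   by the constant [c t] at the cutoff type costs nothing and leaves a pointwise sign. *)
have -> : 0 = mean mu (fun x => c t * (w x y - (B y <= surv x)%R%:R)).
  rewrite meanZ; last by bm.
  rewrite meanB; [|bm|bm].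
  by rewrite meanw mean_surv_ge// subrr mulr0.
apply: (le_mean01 law (a := t)); [bm|bm|] => x x0 x1 xt.
rewrite -mulrBr; have /andP[wx0 wx1] := w01 x y; rewrite sB.
have [xt'|tx|xt'] := ltgtP x t; last by rewrite xt' eqxx in xt.
  rewrite surv_homo ?(ltW xt')//=; apply: ler_wnM2r; first by rewrite subr_le0.
  by apply: cle; exact: ltW.
have st : surv x < surv t by rewrite ltrD2l ltrN2 (F_lt law).
rewrite (leNgt (surv t)) st subr0; apply: ler_wpM2r => //.
by apply: cle; exact: ltW.
Qed.

(** The excess of [A] over [p] is collected on the set where [A] exceeds [p]. On the set of lowest
    types with the same mass [dag B] collects at least as much, and its positive part dominates
    [dag B - p] restricted to any set. Over all [p] this is majorization. *)
Lemma majorize (p : R) : 0 <= p -> p <= 1 ->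
  mean mu (fun x => Num.max (A x - p) 0) <=
  mean mu (fun x => Num.max (dag B x - p) 0).
Proof.
move=> p0 p1; have bF := bm_F mu; have bdB := bm_dag bmB'.
set a := mean mu (fun x => (p < A x)%R%:R).
have a0 : 0 <= a.
  by rewrite /a -(mean_cst mu 0); apply: le_mean; [bm|bm|].
have a1 : a <= 1.
  by rewrite /a -[leRHS](mean_cst mu); apply: le_mean; [bm|bm|] => x; case: ltP.
have mF := mean_F_lt law a0 a1.
(* On [{A > p}], of mass [a], firm 1 can win at most [min a (1 - B y)] against
   type [y]; the allocation behind [dag B] attains this on [{F < a}]. *)
have key : mean mu (fun x => (p < A x)%R%:R * A x) <=
           mean mu (fun x => (F mu x < a)%R%:R * dag B x).
  rewrite (_ : (fun x => (p < A x)%R%:R * A x) =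
      (fun x => mean mu (fun y => (p < A x)%R%:R * w x y))); last first.
    by apply/funext => x; rewrite meanZ//; exact: bm_pair2.
  rewrite (_ : (fun x => (F mu x < a)%R%:R * dag B x) =
      (fun x => mean mu (fun y => (F mu x < a)%R%:R * (B y <= surv x)%R%:R))); last first.
    by apply/funext => x; rewrite meanZ//; bm.
  rewrite [leLHS]mean_fubini; last by bm.
  rewrite [leRHS]mean_fubini; last by bm.
  apply: le_mean => [||y].
  - apply: (@bm_mean _ _ _ _ _ mu (fun y x => (p < A x)%R%:R * w x y)).
    by apply: bmM; [bm | exact: bm_swap bw].
  - by apply: (@bm_mean _ _ _ _ _ mu
      (fun y x => (F mu x < a)%R%:R * (B y <= surv x)%R%:R)); bm.
  have /andP[b0 b1] := B01 y; have bwy := bm2_left y bw.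
  have [ab|/ltW ba] := leP a (1 - B y).
  - apply: (@le_trans _ _ a).
      apply: le_mean; [bm|bm|] => x; have := w01 x y.
      by case: (p < A x)%R; rewrite ?mul1r ?mul0r => /andP[].
    rewrite -{1}mF; apply: le_mean; [bm|bm|] => x.
    case: ltP => [Fx|_]; rewrite ?mul0r// mul1r.
    by rewrite (_ : B y <= surv x)// /surv; lra.
  - apply: (@le_trans _ _ (1 - B y)).
      rewrite -meanw; apply: le_mean; [bm|bm|] => x; have := w01 x y.
      by case: (p < A x)%R; rewrite ?mul1r ?mul0r => /andP[].
    have b0' : 0 <= 1 - B y by lra.
    have b1' : 1 - B y <= 1 by lra.
    rewrite -{1}(mean_F_lt law b0' b1'); apply: le_mean; [bm|bm|] => x.
    case: ltP => [Fx|_]; last by rewrite mulr_ge0.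
    by rewrite (lt_le_trans Fx ba) (_ : B y <= surv x) ?mulr1// /surv; lra.
rewrite (_ : (fun x => Num.max (A x - p) 0) =
    (fun x => (p < A x)%R%:R * A x - (p < A x)%R%:R * p)); last first.
  apply/funext => x; case: ltP => pA.
    by rewrite max_l ?subr_ge0 ?ltW// !mul1r.
  by rewrite max_r ?subr_le0// !mul0r subrr.
rewrite meanB; [|bm|bm]; rewrite meanZr; last by bm.
rewrite -/a -mF -meanZr; last by bm.
apply: (@le_trans _ _ (mean mu (fun x => (F mu x < a)%R%:R * dag B x) -
    mean mu (fun x => (F mu x < a)%R%:R * p))); first by rewrite lerD2r.
rewrite -meanB; [|bm|bm]; apply: le_mean; [bm|bm|] => x.
by rewrite -mulrBr; case: ltP => _; rewrite ?mul1r ?mul0r le_max lexx ?orbT.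
Qed.

(** The expected conjugate is a mixture of excesses over the levels [marg r], all in [0, 1], and
    [majorize] compares each of them. *)
Lemma conj_majorize :
  mean mu (fun x => conjugate g' Q0 (A x)) <=
  mean mu (fun x => conjugate g' Q0 (dag B x)).
Proof.
have bdB := bm_dag bmB'.
rewrite [leLHS](mean_conj bmA) [leRHS](mean_conj bdB).
apply: ler_wpM2l; first exact: ltW.
apply: le_mean => [||r].
- by apply: (@bm_mean _ _ _ _ _ mu (fun r x => Num.max (A x - marg g' Q r) 0)); bm.
- by apply: (@bm_mean _ _ _ _ _ mu (fun r x => Num.max (dag B x - marg g' Q r) 0)); bm.
- by apply: majorize; [exact: (marg_ge0 cost) | exact: (marg_le1 cost)].
Qed.

End Bathtub.
End Contest.

(** * Ironing *)

Section Ironing.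
Context {R : realType}.
Let bmR (h : R -> R) := bm (h : measurableTypeR R -> R).
(* An expectation, kept abstract so that it can also be the expectation of
   [h (1 - x)]. *)
Variable E : (R -> R) -> R.
Hypothesis EB : forall h k, bmR h -> bmR k ->
  E (fun x => h x - k x) = E h - E k.
Hypothesis EZ : forall r h, bmR h -> E (fun x => r * h x) = r * E h.
Hypothesis le_E : forall a h k, bmR h -> bmR k ->
  (forall x, 0 <= x -> x <= 1 -> x != a -> h x <= k x) -> E h <= E k.
Hypothesis tail_gt0 : forall t, t < 1 -> 0 < E (fun x => (t < x)%R%:R).
Hypothesis left_small : forall t e, 0 < e ->
  exists2 s, s < t & E (fun x => (s < x)%R%:R * (x < t)%R%:R) < e.

Let E0 : E (fun=> 0) = 0.
Proof.
have -> : (fun=> 0) = (fun x : R => 0 * 0 : R) by apply/funext => x; rewrite mul0r.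
by rewrite EZ ?mul0r//; exact: bm_cst.
Qed.

Let eq_E a h k : bmR h -> bmR k ->
  (forall x, 0 <= x -> x <= 1 -> x != a -> h x = k x) -> E h = E k.
Proof.
move=> bh bk hk; apply/le_anti/andP; split;
  by apply: (@le_E a) => // x *; rewrite hk.
Qed.

Let bm_id : forall t : R, bmR (fun x => (t < x)%R%:R).
Proof. exact: bm_gt. Qed.

Let bm_lt' : forall t : R, bmR (fun x => (x < t)%R%:R).
Proof. exact: bm_ltq. Qed.

Variable kappa : R -> R.
Hypothesis bk : bmR kappa.
Hypothesis qcvx : forall x y z, 0 <= x -> x < y -> y < z -> z <= 1 ->
  kappa y < Num.max (kappa x) (kappa z).

(* The types at which [kappa] does not exceed its average over higher types. *)
Let S := [set t : R | 0 <= t /\ t <= 1 /\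
  0 <= E (fun x => (t < x)%R%:R * (kappa x - kappa t))].

Let b1 t r : bmR (fun x => (t < x)%R%:R * (kappa x - r)).
Proof. by have h := bm_id t; rewrite /bmR; bm. Qed.

Let S1 : S 1.
Proof.
split => //; split => //; rewrite -[leLHS]E0.
apply: (@le_E 0); [exact: bm_cst|exact: b1|].
by move=> x x0 x1 _; rewrite ltNge x1 mul0r.
Qed.

Let x0 := inf S.

Let x0_le t : S t -> x0 <= t.
Proof. by move=> St; apply: ge_inf St; exists 0 => s []. Qed.

Let x0_ge0 : 0 <= x0.
Proof. by apply: lb_le_inf; [exists 1; exact: S1 | move=> s []]. Qed.

Let x0_le1 : x0 <= 1.
Proof. exact: x0_le S1. Qed.

Let x0_lt t : x0 < t -> exists2 s, S s & s < t.
Proof.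
by apply: inf_lt; exists 1; exact: S1.
Qed.

(** If [kappa] rose from [x] to [y], quasi-convexity would put [kappa] above [kappa y] at all types
    beyond [y]; then [y] would lie in [S], below its infimum. *)
Let decr x y : 0 <= x -> x < y -> y < x0 -> kappa y <= kappa x.
Proof.
move=> x_ge0 xy yx0; rewrite leNgt; apply/negP => kxy.
suff /x0_le : S y by rewrite leNgt yx0.
split; first lra; split; first exact: ltW (lt_le_trans yx0 x0_le1).
rewrite -[leLHS]E0; apply: (@le_E 0); [exact: bm_cst|exact: b1|].
move=> z z0 z1 _; case: ltP => [yz|]; rewrite ?mul0r// mul1r subr_ge0 ltW//.
have := qcvx x_ge0 xy yz z1; rewrite lt_max => /orP[]//; lra.
Qed.

Let Mex : exists2 M, 0 < M & forall x, `|kappa x| <= M.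
Proof.
have [_ [M hM]] := bk; exists (`|M| + 1); first by rewrite ltr_wpDl.
by move=> x; rewrite (le_trans (hM x))// (le_trans (ler_norm M))// lerDl.
Qed.

(** When [x0 < 1], [v] is the average of [kappa] above [x0]. The last clause says that there [kappa]
    crosses [v] at most once, from below. *)
Lemma ironing_level : exists v, [/\ forall x, 0 <= x -> x < x0 -> v <= kappa x,
  E (fun x => (x0 < x)%R%:R * (kappa x - v)) = 0 &
  exists t, forall x, x0 < x -> x <= 1 ->
    (x < t -> kappa x <= v) /\ (t < x -> v <= kappa x)].
Proof.
have [M M0 hM] := Mex.
have kM x : - M <= kappa x <= M by rewrite -ler_norml.
have := x0_le1; rewrite le_eqVlt => /predU1P[x01|x0lt1].
  (* With [x0 = 1] nothing is pooled: any lower bound of [kappa] serves as level, and the crossing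
     point is irrelevant. *)
  exists (- M); split => [x _ _||]; first by have := kM x; lra.
    rewrite -[RHS]E0; apply: (@eq_E 0); [exact: b1|exact: bm_cst|].
    by move=> x _ x1 _; rewrite x01 ltNge x1 mul0r.
  by exists 0 => x; rewrite x01; lra.
have m0 := tail_gt0 x0lt1; set m := E _ in m0.
have bkx : bmR (fun x => (x0 < x)%R%:R * kappa x).
  by have h := bm_id x0; rewrite /bmR; bm.
pose v := E (fun x => (x0 < x)%R%:R * kappa x) / m.
have Ev r : E (fun x => (x0 < x)%R%:R * (kappa x - r)) = (v - r) * m.
  rewrite (_ : (fun x => _) =
      (fun x => (x0 < x)%R%:R * kappa x - r * (x0 < x)%R%:R)).
    rewrite EB// ?EZ//; last first.
      by have h := bm_id x0; rewrite /bmR; bm.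
    by rewrite -/m mulrBl /v divfK// gt_eqF.
  by apply/funext => x; rewrite mulrBr [r * _]mulrC.
exists v; split.
- move=> t t_ge0 tx0; rewrite leNgt; apply/negP => ktv.
  (* If [kappa t < v] with [t < x0], some [s] in ]t, x0[ would belong to [S]: [kappa s] falls short
     of [v] by at least [v - kappa t], and the types in ]s, x0[ lower the tail expectation by at
     most [2 * M] times their mass. The tolerance balances the two. *)
  have e0 : 0 < (v - kappa t) * m / (2 * M).
    by rewrite divr_gt0 ?mulr_gt0 ?subr_gt0.
  have [y yx0 ye] := left_small x0 e0.
  pose s := Num.max y ((t + x0) / 2).
  have ys : y <= s by rewrite /s le_max lexx.
  have ts : t < s by rewrite /s lt_max; apply/orP; right; lra.
  have sx0 : s < x0 by rewrite /s gt_max yx0/=; lra.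
  have ks := decr t_ge0 ts sx0.
  have : ~ S s by move=> /x0_le; rewrite leNgt sx0.
  apply; split; first lra; split; first lra.
  have bys : bmR (fun x => (y < x)%R%:R * (x < x0)%R%:R).
    by have h1 := bm_id y; have h2 := bm_lt' x0; rewrite /bmR; bm.
  have b2 : bmR (fun x => (2 * M) * ((y < x)%R%:R * (x < x0)%R%:R)).
    by rewrite /bmR; bm.
  apply: (@le_trans _ _ (E (fun x => (x0 < x)%R%:R * (kappa x - kappa s) -
      (2 * M) * ((y < x)%R%:R * (x < x0)%R%:R)))).
    rewrite EB// Ev EZ// subr_ge0.
    have : 2 * M * E (fun x => (y < x)%R%:R * (x < x0)%R%:R) <= (v - kappa t) * m.
      by rewrite mulrC -ler_pdivlMr ?mulr_gt0// ltW.
    move=> /le_trans; apply; rewrite ler_pM2r//; lra.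
  apply: (@le_E x0); [by have b1' := b1 x0 (kappa s); rewrite /bmR; bm|exact: b1|].
  move=> x _ _ xx0; have := kM x; have := kM s.
  have [xl|xg|xe] := ltgtP x x0; last by rewrite xe eqxx in xx0.
    rewrite mul0r sub0r mulr1; have [sx|xs] := ltP s x.
      rewrite (le_lt_trans ys sx) mulr1 mul1r; lra.
    rewrite mul0r oppr_le0 mulr_ge0// mulr_ge0//; lra.
  rewrite mulr0 mulr0 subr0 (lt_trans sx0 xg); lra.
- by rewrite Ev subrr mul0r.
(* A fall from above [v] to below [v] would, by quasi-convexity, keep [kappa] above [v] on all of
   [0, t], in particular at some [s] of [S] with [x0 <= s < t]. Membership in [S] puts the average
   beyond [s] above [v], whereas dropping the high values on ]x0, s] leaves it at most [v]. *)
have up t t' : x0 < t -> t < t' -> t' <= 1 -> v < kappa t -> v <= kappa t'.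
  move=> x0t tt' t'1 vt; rewrite leNgt; apply/negP => t'v.
  have big r : 0 <= r -> r < t -> v < kappa r.
    move=> r0 rt; have := qcvx r0 rt tt' t'1.
    by rewrite lt_max => /orP[]; lra.
  have [s Ss st] := x0_lt x0t; have x0s := x0_le Ss.
  have [s0 [s1 ES]] := Ss; have vs := big s s0 st.
  have ms : 0 < E (fun x => (s < x)%R%:R) by apply: tail_gt0; lra.
  have : E (fun x => (s < x)%R%:R * (kappa x - v)) <= 0.
    rewrite (_ : 0 = E (fun x => (x0 < x)%R%:R * (kappa x - v))); last first.
      by rewrite Ev subrr mul0r.
    apply: (@le_E 0); [exact: b1|exact: b1|] => x xge0 x1 _.
    have [sx|xs] := ltP s x; first by rewrite (le_lt_trans x0s sx).
    rewrite mul0r mulr_ge0// subr_ge0 ltW// big//; lra.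
  suff : 0 < E (fun x => (s < x)%R%:R * (kappa x - v)) by lra.
  apply: (@lt_le_trans _ _ ((kappa s - v) * E (fun x => (s < x)%R%:R))).
    by rewrite mulr_gt0// subr_gt0.
  rewrite -EZ//; apply: (@le_trans _ _ (E (fun x => (s < x)%R%:R * (kappa x - v) -
      (s < x)%R%:R * (kappa x - kappa s)))).
    apply: (@le_E 0) => [||x _ _ _].
    - by have h := bm_id s; rewrite /bmR; bm.
    - by have h := b1 s v; have h' := b1 s (kappa s); rewrite /bmR; bm.
    - by rewrite -mulrBr mulrC ler_wpM2l//; lra.
  by rewrite EB// gerBl.
have [[t [x0t t1 vt]]|none] :=
    pselect (exists t, [/\ x0 < t, t <= 1 & v < kappa t]); last first.
  (* [kappa] never exceeds [v] on the pool, so any crossing point beyond 1 will do. *)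
  exists 2 => x x0x x1; split => [_|]; last by lra.
  by rewrite leNgt; apply/negP => vx; apply: none; exists x.
pose A := [set t | [/\ x0 < t, t <= 1 & v < kappa t]].
exists (inf A) => x x0x x1; split => [xA|Ax].
  rewrite leNgt; apply/negP => vx.
  suff : inf A <= x by rewrite leNgt xA.
  by apply: ge_inf; [exists x0 => s [/ltW]|split].
have [s [x0s s1 vs] sx] := inf_lt (ex_intro A t (And3 x0t t1 vt)) Ax.
exact: up vs.
Qed.

(** [kbar] is [kappa] below [x0] and its pool level [v] from there on. As [kappa - v] has mean zero
    on the pool, any constant may be subtracted from [Z] when the two functionals are compared
    ([diff]): this yields the equality for [Z] constant on the pool, and the inequality through
    single crossing. *)
Lemma ironing : exists a kbar, [/\ 0 <= a, a <= 1, bmR kbar,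
  forall x y, 0 <= x -> x <= y -> y <= 1 -> kbar y <= kbar x &
  [/\ forall x, a <= x -> kbar x = kbar a,
  forall Z, bmR Z -> (forall x y, 0 <= x -> x <= y -> y <= 1 -> Z y <= Z x) ->
    E (fun x => kappa x * Z x) <= E (fun x => kbar x * Z x) &
  forall Z c, bmR Z -> (forall x, a < x -> x <= 1 -> Z x = c) ->
    E (fun x => kappa x * Z x) = E (fun x => kbar x * Z x)]].
Proof.
have [v [vle Ev [t ht]]] := ironing_level.
pose kbar x := if x < x0 then kappa x else v.
have kbarE : kbar = (fun x => v + (x < x0)%R%:R * (kappa x - v)).
  by apply/funext => x; rewrite /kbar; case: ifP => _;
      rewrite ?mul1r ?mul0r ?addr0// addrC subrK.
have bkb : bmR kbar.
  by have h := bm_lt' x0; rewrite /bmR kbarE; bm.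
have diff Z c : bmR Z -> E (fun x => kappa x * Z x) - E (fun x => kbar x * Z x) =
    E (fun x => (x0 < x)%R%:R * (kappa x - v) * (Z x - c)).
  move=> bZ; have b1' := b1 x0 v.
  rewrite -EB; [|by rewrite /bmR; bm|by rewrite /bmR; bm].
  rewrite -[LHS]subr0 -[X in _ - X](mulr0 c) -Ev -EZ; last by rewrite /bmR; bm.
  rewrite -EB; [|by rewrite /bmR; bm|by rewrite /bmR; bm].
  apply: (@eq_E x0); [by rewrite /bmR; bm|by rewrite /bmR; bm|].
  move=> x _ _ xx0; rewrite /kbar.
  have [xl|xg|xe] := ltgtP x x0; last by rewrite xe eqxx in xx0.
    by rewrite !mul0r mulr0 !subrr.
  by rewrite !mul1r; ring.
exists x0, kbar; split => //; last split.
- move=> x y x_ge0 xy y1; rewrite /kbar.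
  have [yl|yg] := ltP y x0.
    rewrite (le_lt_trans xy yl); move: xy; rewrite le_eqVlt => /predU1P[->//|xy].
    exact: decr.
  by case: ltP => // xl; exact: vle.
- by move=> x ax; rewrite /kbar ltxx ltNge ax.
(* The constant is the value of [Z] at the crossing point, so [kappa - v] and [Z] minus that value
   have opposite signs on both sides. The point is projected onto [0, 1] because [Z] is monotone
   only there. *)
- move=> Z bZ Zle; rewrite -subr_le0 (diff Z (Z (Num.min (Num.max t 0) 1)))//.
  have b1' := b1 x0 v.
  rewrite -[leRHS]E0; apply: (@le_E t); [by rewrite /bmR; bm|exact: bm_cst|].
  move=> x x_ge0 x1 xt; have [x0x|] := ltP x0 x; last by rewrite !mul0r.
  rewrite mul1r; have [h1 h2] := ht x x0x x1.
  have [xl|xg|xe] := ltgtP x t; last by rewrite xe eqxx in xt.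
    apply: mulr_le0_ge0; first by rewrite subr_le0 h1.
    rewrite subr_ge0; apply: Zle => //; last by rewrite ge_min lexx orbT.
    by rewrite le_min x1 le_max (ltW xl).
  apply: mulr_ge0_le0; first by rewrite subr_ge0 h2.
  rewrite subr_le0; apply: Zle => //; first by rewrite le_min ler01 le_max lexx orbT.
  by rewrite ge_min ge_max (ltW xg) x_ge0.
- move=> Z c bZ Zc; apply/eqP; rewrite -subr_eq0 (diff Z c)//; apply/eqP.
  have b1' := b1 x0 v.
  rewrite -[RHS]E0; apply: (@eq_E 0); [by rewrite /bmR; bm|exact: bm_cst|].
  move=> x _ x1 _; have [x0x|] := ltP x0 x; last by rewrite !mul0r.
  by rewrite Zc// subrr mulr0.
Qed.

End Ironing.

(** * The upper bound and when it is attained *)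

Section Payoff.
Context {R : realType}.
Variables (mu : probability (measurableTypeR R) R) (f : R -> R).
Hypothesis law : type_law mu f.
Variables (g g' : R -> R) (Q : R).
Hypotheses (cost : investment_cost g g') (Q0 : 0 < Q) (Q1 : g' Q = 1).
Variable c : R -> R.
Hypotheses (bc : bm (c : measurableTypeR R -> R))
  (c_noninc : forall x y, x <= y -> c y <= c x).

Let phi := phi mu g' Q0.
Let conjugate := conjugate g' Q0.
Let s := surv mu.
Let bphi : bm (phi : measurableTypeR R -> R) := bm_phi mu cost Q0 Q1.
Let bsurv : bm (s : measurableTypeR R -> R) := bm_surv mu.

(* The virtual value of the winner: under a monotone deterministic allocation the
   surplus is the expectation of [kappa] at the winner's type plus a constant. *)
Definition kappa (x : R) := c x - phi x.

Lemma bm_kappa : bm (kappa : measurableTypeR R -> R).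
Proof. by rewrite /kappa; bm. Qed.

(** Bookkeeping for [surplus_le] over plain reals: [u] and [v] are the expected conjugates of the
    two firms, and each cancels against the term produced by rewriting the other firm's [c]
    expectation with [kappa]. *)
Let arith1 (cA cT cB dA dT dB dTT kT kTT p u v : R) : cA <= cT -> dA <= dT ->
    dB <= dTT -> cT = u -> cB = v -> kT + p = dT + v -> kTT + p = dTT + u ->
    cA + dA + (cB + dB) <= 2 * p + kT + kTT.
Proof. lra. Qed.

Let arith2 (cA cB dA dB kA kB p u v : R) : cA = u -> cB = v ->
    kA + p = dA + v -> kB + p = dB + u ->
    cA + dA + (cB + dB) = 2 * p + kA + kB.
Proof. lra. Qed.

Let arith3 (p kT kTT bT' bTT A B : R) : kT <= bT' -> kTT <= bTT ->
    bT' + bTT <= A + B -> 2 * p + kT + kTT <= 2 * p + A + B.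
Proof. lra. Qed.

Let dag01 B y : bm (B : measurableTypeR R -> R) -> 0 <= dag mu B y <= 1.
Proof.
move=> bB; apply: unit_mean; first by bm.
by move=> x; case: (B x <= _)%R; rewrite ?lexx ?ler01.
Qed.

Definition surplus (A B : R -> R) :=
  mean mu (fun x => conjugate (A x)) + mean mu (fun x => c x * A x) +
  (mean mu (fun x => conjugate (B x)) + mean mu (fun x => c x * B x)).

(* Replacing firm 1's reduced form by [T = dag B] and then firm 2's by [dag T]
   can only help, and [mean_conj_dag] makes the result linear in [(T, dag T)]. *)
Lemma surplus_le (w : R -> R -> R) : bm2 w ->
  (forall x y, 0 <= w x y <= 1) ->
  exists T, [/\ bm (T : measurableTypeR R -> R), forall x, 0 <= T x <= 1,
    forall x y, x <= y -> T y <= T x &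
    surplus (reduced1 mu w) (reduced2 mu w) <= 2 * mean mu phi +
      mean mu (fun x => kappa x * T x) + mean mu (fun x => kappa x * dag mu T x)].
Proof.
move=> bw w01; have bB := bm_reduced2 mu bw; set B := reduced2 mu w in bB *.
have B01 y : 0 <= B y <= 1.
  apply: unit_mean; first by apply: bmB; [bm | exact: bm2_left].
  by move=> x; have := w01 x y; lra.
pose T := dag mu B; have bT : bm (T : measurableTypeR R -> R) := bm_dag mu bB.
have T01 x : 0 <= T x <= 1 by exact: dag01.
have bdT : bm (dag mu T : measurableTypeR R -> R) := bm_dag mu bT.
exists T; split => //.
  move=> x y xy; apply: le_mean; [bm|bm|] => z.
  rewrite ler_nat; case: (leP (B z) (s y)) => //= Bz.
  by rewrite (le_trans Bz)// surv_homo.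
have hA : mean mu (fun x => conjugate (reduced1 mu w x)) <=
    mean mu (fun x => conjugate (T x)).
  exact: (conj_majorize law cost Q0 Q1 bw w01).
have hc : mean mu (fun x => c x * reduced1 mu w x) <= mean mu (fun x => c x * T x).
  exact: (bathtub law bw w01 bc c_noninc).
have hc2 : mean mu (fun x => c x * B x) <= mean mu (fun x => c x * dag mu T x).
  (* An auxiliary allocation with the roles of the firms exchanged: its reduced forms are [B] and
     [T], so [bathtub] compares [B] with [dag T]. The conjugate of [B] needs no such step, since
     [dag B] is [T] already. *)
  pose k y x : R := 1 - (B y <= s x)%R%:R.
  have bk : bm2 k by rewrite /bm2 /k; bm.
  have k01 y x : 0 <= k y x <= 1.
    by rewrite /k; case: (B y <= s x)%R; rewrite ?subrr ?subr0 lexx ler01.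
  have := bathtub law bk k01 bc c_noninc.
  have -> : reduced1 mu k = B.
    apply/funext => y; rewrite /reduced1 /k meanB ?mean_cst; [|bm|bm].
    by have /andP[b0 b1] := B01 y; rewrite (mean_surv_ge law)//; ring.
  suff -> : reduced2 mu k = T by [].
  apply/funext => y; apply: mean_ext => x.
  by rewrite /k opprB addrCA subrr addr0.
have e1 : mean mu (fun x => conjugate (T x)) =
    mean mu (fun t => phi t * (1 - dag mu T t)).
  exact: (mean_conj_dag law cost Q0 Q1 bT T01).
have e2 : mean mu (fun x => conjugate (B x)) = mean mu (fun t => phi t * (1 - T t)).
  exact: (mean_conj_dag law cost Q0 Q1 bB B01).
have spl Z : bm (Z : measurableTypeR R -> R) ->
    mean mu (fun x => kappa x * Z x) + mean mu phi =
    mean mu (fun x => c x * Z x) + mean mu (fun t => phi t * (1 - Z t)).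
  move=> bZ; have bkap := bm_kappa; rewrite -!meanD; [|bm|bm|bm|bm].
  by apply: mean_ext => x; rewrite /kappa; ring.
exact: (arith1 hA hc hc2 e1 e2 (spl _ bT) (spl _ bdT)).
Qed.

(** * Optimality of a threshold allocation that follows the ironed value *)

Section Verification.
(** [t1 x] is the rival type above which firm 1 of type [x] wins, and [t2 y] plays the same part for
    firm 2; the winning probabilities are then [surv] of these cutoffs. The outcome at a cutoff
    itself stays free, having probability zero. *)
Variables (kbar : R -> R) (w0 : R -> R -> R) (t1 t2 : R -> R).
Hypotheses (bkbar : bm (kbar : measurableTypeR R -> R))
  (iron : forall Z, bm (Z : measurableTypeR R -> R) ->
    (forall x y, 0 <= x -> x <= y -> y <= 1 -> Z y <= Z x) ->
    mean mu (fun x => kappa x * Z x) <= mean mu (fun x => kbar x * Z x))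
  (bw0 : bm2 w0)
  (t1_in : forall x, 0 <= x -> x <= 1 -> 0 <= t1 x <= 1)
  (t2_in : forall x, 0 <= x -> x <= 1 -> 0 <= t2 x <= 1)
  (w0t1 : forall x y, 0 <= x -> x <= 1 -> 0 <= y -> y <= 1 -> y != t1 x ->
    w0 x y = (t1 x < y)%R%:R)
  (w0t2 : forall x y, 0 <= x -> x <= 1 -> 0 <= y -> y <= 1 -> x != t2 y ->
    1 - w0 x y = (t2 y < x)%R%:R)
  (pool1 : mean mu (fun x => kappa x * reduced1 mu w0 x) =
           mean mu (fun x => kbar x * reduced1 mu w0 x))
  (pool2 : mean mu (fun x => kappa x * reduced2 mu w0 x) =
           mean mu (fun x => kbar x * reduced2 mu w0 x))
  (winner : forall x y, 0 <= x -> x <= 1 -> 0 <= y -> y <= 1 ->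
    Num.max (kbar x) (kbar y) <= kbar x * w0 x y + kbar y * (1 - w0 x y)).

Let bA0 := bm_reduced1 mu bw0.
Let bB0 := bm_reduced2 mu bw0.

Let bw0' y : bm (w0^~ y : measurableTypeR R -> R).
Proof. exact: bm2_left. Qed.

Let red1E x : 0 <= x -> x <= 1 -> reduced1 mu w0 x = s (t1 x).
Proof.
move=> x0 x1; rewrite /s /surv -mean_gt.
apply: (eq_mean01 law (a := t1 x)); [exact: bm_pair2|exact: bm_gt|].
by move=> y y0 y1 yt; exact: w0t1.
Qed.

Let red2E y : 0 <= y -> y <= 1 -> reduced2 mu w0 y = s (t2 y).
Proof.
move=> y0 y1; rewrite /s /surv -mean_gt; have b := bw0' y.
apply: (eq_mean01 law (a := t2 y)); [bm|exact: bm_gt|].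
by move=> x x0 x1 xt; exact: w0t2.
Qed.

Let s01 x : 0 <= s x <= 1. Proof. exact: surv01. Qed.

Let conj_s t : 0 <= t -> t <= 1 ->
  conjugate (s t) = mean mu (fun y => phi y * (t < y)%R%:R).
Proof.
move=> t0 t1'; have /andP[h0 h1] := s01 t.
have b := @bm_gt R t.
rewrite /conjugate (conj_phi law cost Q0 Q1)//; apply: (eq_mean01 law (a := t)); [bm|bm|].
move=> y y0 y1 yt; congr (_ * (nat_of_bool _)%:R); rewrite /surv ltrD2l ltrN2.
have [yl|yg|ye] := ltgtP y t; last by rewrite ye eqxx in yt.
  by apply/negbTE; rewrite -leNgt F_homo// ltW.
by rewrite (F_lt law).
Qed.

(** For a threshold allocation [phi y] is collected exactly at the profiles where firm 1 wins, so
    the identity of [mean_conj_dag] holds with firm 2's actual winning probability in place of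
    [dag]. *)
Let conj1 : mean mu (fun x => conjugate (reduced1 mu w0 x)) =
  mean mu (fun y => phi y * (1 - reduced2 mu w0 y)).
Proof.
have bcA : bm (fun x : measurableTypeR R => conjugate (reduced1 mu w0 x)).
  exact: (bm_conj cost Q0 Q1 bA0).
transitivity (mean mu (fun x => mean mu (fun y => phi y * w0 x y))).
  apply: (eq_mean01 law (a := 0)); [bm|bm|] => x x0 x1 _.
  have /andP[t0 t1'] := t1_in x0 x1.
  rewrite red1E// conj_s//; have b := @bm_gt R (t1 x).
  apply: (eq_mean01 law (a := t1 x)); [bm|bm|] => y y0 y1 yt.
  by rewrite w0t1.
rewrite mean_fubini; last by bm.
apply: mean_ext => y; have b := bw0' y; rewrite meanZ; last by bm.
congr (_ * _); rewrite /reduced2 meanB ?mean_cst; [|bm|bm].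
by rewrite opprB addrCA subrr addr0.
Qed.

Let conj2 : mean mu (fun x => conjugate (reduced2 mu w0 x)) =
  mean mu (fun y => phi y * (1 - reduced1 mu w0 y)).
Proof.
have bcB : bm (fun x : measurableTypeR R => conjugate (reduced2 mu w0 x)).
  exact: (bm_conj cost Q0 Q1 bB0).
transitivity (mean mu (fun y => mean mu (fun x => phi x * (1 - w0 x y)))).
  apply: (eq_mean01 law (a := 0)); [bm| |].
    apply: (@bm_mean _ _ _ _ _ mu (fun y x => phi x * (1 - w0 x y))).
    by apply: bmM; [bm|apply: bmB; [bm|exact: bm_swap bw0]].
  move=> y y0 y1 _; have b' := bw0' y.
  have /andP[t0 t1'] := t2_in y0 y1.
  rewrite red2E// conj_s//; have b := @bm_gt R (t2 y).
  apply: (eq_mean01 law (a := t2 y)); [bm|bm|] => x x0 x1 xt.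
  by rewrite w0t2.
rewrite -mean_fubini; last by bm.
apply: mean_ext => x; rewrite meanZ; last by bm.
by congr (_ * _); rewrite /reduced1 meanB ?mean_cst; [|bm|bm].
Qed.

Let surplus0 : surplus (reduced1 mu w0) (reduced2 mu w0) = 2 * mean mu phi +
  mean mu (fun x => kbar x * reduced1 mu w0 x) +
  mean mu (fun x => kbar x * reduced2 mu w0 x).
Proof.
rewrite -pool1 -pool2.
have spl Z : bm (Z : measurableTypeR R -> R) ->
    mean mu (fun x => kappa x * Z x) + mean mu phi =
    mean mu (fun x => c x * Z x) + mean mu (fun t => phi t * (1 - Z t)).
  move=> bZ; have bkap := bm_kappa; rewrite -!meanD; [|bm|bm|bm|bm].
  by apply: mean_ext => x; rewrite /kappa; ring.
exact: (arith2 conj1 conj2 (spl _ bA0) (spl _ bB0)).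
Qed.

(** Writing the two one-type expectations as one over profiles reduces the maximization to a
    pointwise choice of winner. *)
Let mix (k : R -> R -> R) : bm2 k ->
  mean mu (fun x => mean mu (fun y => kbar x * k x y + kbar y * (1 - k x y))) =
  mean mu (fun x => kbar x * reduced1 mu k x) +
  mean mu (fun y => kbar y * reduced2 mu k y).
Proof.
move=> bk; rewrite [LHS](_ : _ = mean mu (fun x => mean mu (fun y => kbar x * k x y)) +
    mean mu (fun x => mean mu (fun y => kbar y * (1 - k x y)))).
  congr (_ + _).
    by apply: mean_ext => x; rewrite meanZ//; exact: bm_pair2.
  rewrite mean_fubini; last by bm.
  apply: mean_ext => y; rewrite meanZ//.
  apply: bmB; first bm.
  exact: bm2_left.
rewrite -meanD; [|bm|bm]; apply: mean_ext => x; rewrite meanD//.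
  by apply: bmM; [bm|exact: bm_pair2].
by apply: bmM; [bm|apply: bmB; [bm|exact: bm_pair2]].
Qed.

Lemma surplus_max (w : R -> R -> R) : bm2 w -> (forall x y, 0 <= w x y <= 1) ->
  surplus (reduced1 mu w) (reduced2 mu w) <= surplus (reduced1 mu w0) (reduced2 mu w0).
Proof.
move=> bw w01; have [T [bT T01 T_le /le_trans]] := surplus_le bw w01; apply.
have bdT := bm_dag mu bT.
have dT_le x y : x <= y -> dag mu T y <= dag mu T x.
  move=> xy; apply: le_mean; [bm|bm|] => z.
  rewrite ler_nat; case: (leP (T z) (s y)) => //= Tz.
  by rewrite (le_trans Tz)// surv_homo.
have i1 : mean mu (fun x => kappa x * T x) <= mean mu (fun x => kbar x * T x).
  by apply: iron => // x y _ xy _; exact: T_le.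
have i2 : mean mu (fun x => kappa x * dag mu T x) <=
          mean mu (fun x => kbar x * dag mu T x).
  by apply: iron => // x y _ xy _; exact: dT_le.
(* A genuine allocation with reduced forms [T] and [dag T], so that it can be compared with [w0]
   profile by profile. *)
pose k x y : R := 1 - (T x <= s y)%R%:R.
have bk : bm2 k by rewrite /bm2 /k; bm.
have r1 : reduced1 mu k = T.
  apply/funext => x; rewrite /reduced1 /k meanB ?mean_cst; [|bm|bm].
  by have /andP[h0 h1] := T01 x; rewrite (mean_surv_ge law)//; ring.
have r2 : reduced2 mu k = dag mu T.
  apply/funext => y; apply: mean_ext => x.
  by rewrite /k opprB addrCA subrr addr0.
have := mix bk; rewrite r1 r2 => mixk.
have : mean mu (fun x => mean mu (fun y => kbar x * k x y + kbar y * (1 - k x y))) <=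
    mean mu (fun x => mean mu (fun y => kbar x * w0 x y + kbar y * (1 - w0 x y))).
  apply: (le_mean01 law (a := 0)); [bm|bm|] => x x0 x1 _.
  have bkx : bm (k x : measurableTypeR R -> R) by exact: bm_pair2.
  have bwx : bm (w0 x : measurableTypeR R -> R) by exact: bm_pair2.
  apply: (le_mean01 law (a := 0)); [bm|bm|] => y y0 y1 _.
  apply: le_trans (winner x0 x1 y0 y1); rewrite /k.
  case: (T x <= s y)%R.
    by rewrite subrr mulr0 add0r subr0 mulr1 le_max lexx orbT.
  by rewrite subr0 mulr1 subrr mulr0 addr0 le_max lexx.
rewrite (mix bw0) mixk surplus0 => mix_le.
exact: (arith3 _ i1 i2 mix_le).
Qed.

Definition payoff (q1 q2 : R -> R) (w : R -> R -> R) :=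
  mean mu (fun x => mean mu (fun y =>
    ((q1 x + c x) * w x y - g (q1 x)) + ((q2 y + c y) * (1 - w x y) - g (q2 y)))).

Let payoffE q1 q2 w : bm (q1 : measurableTypeR R -> R) ->
  bm (q2 : measurableTypeR R -> R) ->
  (forall x, 0 <= q1 x <= Q) -> (forall x, 0 <= q2 x <= Q) -> bm2 w ->
  payoff q1 q2 w =
  mean mu (fun x => (q1 x * reduced1 mu w x - g (q1 x)) + c x * reduced1 mu w x) +
  mean mu (fun y => (q2 y * reduced2 mu w y - g (q2 y)) + c y * reduced2 mu w y).
Proof.
move=> bq1 bq2 q101 q201 bw.
have bg1 := bm_g cost bq1 q101; have bg2 := bm_g cost bq2 q201.
have bg1' := @bm_fst _ _ _ _ (measurableTypeR R) _ bg1.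
have bg2' := @bm_snd _ _ _ (measurableTypeR R) _ _ bg2.
have bw1 x : bm (w x : measurableTypeR R -> R) by exact: bm_pair2.
have bw2 y : bm (fun x => w x y : R) by exact: bm2_left.
have E1 : mean mu (fun x => mean mu (fun y => (q1 x + c x) * w x y - g (q1 x))) =
    mean mu (fun x => (q1 x * reduced1 mu w x - g (q1 x)) + c x * reduced1 mu w x).
  apply: mean_ext => x; have b := bw1 x.
  rewrite meanB ?mean_cst; [|bm|bm].
  rewrite meanZ; last by bm.
  by rewrite (_ : mean mu _ = reduced1 mu w x)//; ring.
have E2 : mean mu (fun x => mean mu (fun y => (q2 y + c y) * (1 - w x y) - g (q2 y))) =
    mean mu (fun y => (q2 y * reduced2 mu w y - g (q2 y)) + c y * reduced2 mu w y).
  rewrite mean_fubini; last by bm.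
  apply: mean_ext => y; have b := bw2 y.
  rewrite meanB ?mean_cst; [|bm|bm].
  rewrite meanZ; last by bm.
  by rewrite (_ : mean mu _ = reduced2 mu w y)//; ring.
rewrite -E1 -E2 -meanD; [|bm|bm].
by apply: mean_ext => x; have b := bw1 x; rewrite meanD; [|bm|bm].
Qed.

Lemma payoff_le q1 q2 w : bm (q1 : measurableTypeR R -> R) ->
  bm (q2 : measurableTypeR R -> R) ->
  (forall x, 0 <= q1 x <= Q) -> (forall x, 0 <= q2 x <= Q) -> bm2 w ->
  (forall x y, 0 <= w x y <= 1) ->
  payoff q1 q2 w <= surplus (reduced1 mu w0) (reduced2 mu w0).
Proof.
move=> bq1 bq2 q101 q201 bw w01; apply: le_trans (surplus_max bw w01).
have bg1 := bm_g cost bq1 q101; have bg2 := bm_g cost bq2 q201.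
have bA := bm_reduced1 mu bw; have bB := bm_reduced2 mu bw.
have bcA : bm (fun x : measurableTypeR R => conjugate (reduced1 mu w x)).
  exact: (bm_conj cost Q0 Q1 bA).
have bcB : bm (fun x : measurableTypeR R => conjugate (reduced2 mu w x)).
  exact: (bm_conj cost Q0 Q1 bB).
rewrite (payoffE bq1 bq2 q101 q201 bw) /surplus; apply: lerD; rewrite -meanD.
- apply: le_mean; [bm|bm|] => x; have /andP[h0 h1] := q101 x.
  by rewrite lerD2r mulrC; exact: (young cost Q0 Q1).
- by bm.
- by bm.
- apply: le_mean; [bm|bm|] => x; have /andP[h0 h1] := q201 x.
  by rewrite lerD2r mulrC; exact: (young cost Q0 Q1).
- by bm.
- by bm.
Qed.

Lemma payoff_eq q1 q2 : bm (q1 : measurableTypeR R -> R) ->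
  bm (q2 : measurableTypeR R -> R) ->
  (forall x, 0 <= q1 x <= Q) -> (forall x, 0 <= q2 x <= Q) ->
  (forall x, 0 <= x -> x <= 1 -> q1 x = phi (t1 x)) ->
  (forall x, 0 <= x -> x <= 1 -> q2 x = phi (t2 x)) ->
  payoff q1 q2 w0 = surplus (reduced1 mu w0) (reduced2 mu w0).
Proof.
move=> bq1 bq2 q101 q201 q1E q2E.
have bg1 := bm_g cost bq1 q101; have bg2 := bm_g cost bq2 q201.
have bcA : bm (fun x : measurableTypeR R => conjugate (reduced1 mu w0 x)).
  exact: (bm_conj cost Q0 Q1 bA0).
have bcB : bm (fun x : measurableTypeR R => conjugate (reduced2 mu w0 x)).
  exact: (bm_conj cost Q0 Q1 bB0).
have attained x q : q = phi x -> q * s x - g q = conjugate (s x).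
  move=> ->; have [q0 qQ gq] := phiP mu cost Q0 Q1 x.
  by rewrite /conjugate /s -gq (young_eq cost Q0 Q1)// mulrC.
rewrite (payoffE bq1 bq2 q101 q201 bw0) /surplus; congr (_ + _); rewrite -meanD.
- apply: (eq_mean01 law (a := 0)); [bm|bm|] => x x0 x1 _.
  by congr (_ + _); rewrite (red1E x0 x1) (attained (t1 x))// q1E.
- by bm.
- by bm.
- apply: (eq_mean01 law (a := 0)); [bm|bm|] => x x0 x1 _.
  by congr (_ + _); rewrite (red2E x0 x1) (attained (t2 x))// q2E.
- by bm.
- by bm.
Qed.

End Verification.
End Payoff.

(** * Ironing under the law of a type, at either end *)

Section IroningInstances.
Context {R : realType}.
Variables (mu : probability (measurableTypeR R) R) (f : R -> R).
Hypothesis law : type_law mu f.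

Lemma mean_between (a b : R) : a <= b ->
  mean mu (fun x => (a < x)%R%:R * (x < b)%R%:R) <= F mu b - F mu a.
Proof.
move=> ab; have h1 := @bm_gt R a; have h2 := @bm_ltq R b; have h3 := @bm_gt R b.
have -> : F mu b - F mu a = mean mu (fun x => (a < x)%R%:R - (b < x)%R%:R).
  by rewrite meanB// !mean_gt; ring.
apply: le_mean; [bm|bm|] => x.
have [bx|xb] := ltP b x.
  by rewrite (le_lt_trans ab bx) ltNge (ltW bx) mulr0 subrr.
rewrite subr0; case: (a < x)%R; rewrite ?mul0r// mul1r.
by case: (x < b)%R.
Qed.

Lemma F_gt0 (t : R) : 0 < t -> 0 < F mu t.
Proof.
move=> t0; rewrite -(F_le0 law (lexx 0)).
have [t1|t1] := leP t 1; first exact: (F_lt law).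
by rewrite (F_ge1 law (ltW t1)) -[ltRHS](F_ge1 law (lexx 1)) (F_lt law).
Qed.

Lemma F_lt1 (t : R) : t < 1 -> F mu t < 1.
Proof.
move=> t1; rewrite -[ltRHS](F_ge1 law (lexx 1)).
have [t0|t0] := leP 0 t; first exact: (F_lt law).
by rewrite (F_le0 law (ltW t0)) F_gt0.
Qed.

(** A type at which [F] takes the level [F t - e / 2], cut at 0, must lie to the left of [t] by
    monotonicity; this works for any real [t], inside [0, 1] or not. *)
Lemma F_left (t e : R) : 0 < e -> exists2 s, s < t & F mu t - F mu s < e.
Proof.
move=> e0; have F0 := F_ge0 mu t; have F1 := F_le1 mu t.
have [Ft0|Ft] := leP (F mu t) 0.
  exists (t - 1); first lra.
  by have := F_ge0 mu (t - 1); lra.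
have p0 : 0 <= Num.max 0 (F mu t - e / 2) by rewrite le_max lexx.
have p1 : Num.max 0 (F mu t - e / 2) <= 1 by rewrite ge_max ler01/=; lra.
have [s [s0 s1 Fs]] := F_surj law p0 p1.
have pt : Num.max 0 (F mu t - e / 2) < F mu t by rewrite gt_max Ft/=; lra.
exists s; last first.
  have : F mu t - e / 2 <= F mu s by rewrite Fs le_max lexx orbT.
  lra.
by rewrite ltNge; apply/negP => /(F_homo mu); rewrite Fs leNgt pt.
Qed.

Lemma F_right (t e : R) : 0 < e -> exists2 s, t < s & F mu s - F mu t < e.
Proof.
move=> e0; have F0 := F_ge0 mu t; have F1 := F_le1 mu t.
have [Ft1|Ft] := leP 1 (F mu t).
  exists (t + 1); first lra.
  by have := F_le1 mu (t + 1); lra.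
have p0 : 0 <= Num.min 1 (F mu t + e / 2) by rewrite le_min ler01/=; lra.
have p1 : Num.min 1 (F mu t + e / 2) <= 1 by rewrite ge_min lexx.
have [s [s0 s1 Fs]] := F_surj law p0 p1.
have pt : F mu t < Num.min 1 (F mu t + e / 2) by rewrite lt_min Ft/=; lra.
exists s; last first.
  have : F mu s <= F mu t + e / 2 by rewrite Fs ge_min lexx orbT.
  lra.
by rewrite ltNge; apply/negP => /(F_homo mu); rewrite Fs leNgt pt.
Qed.

Variable k : R -> R.
Hypothesis bk : bm (k : measurableTypeR R -> R).

Lemma ironing_convex :
  (forall x y z, 0 <= x -> x < y -> y < z -> z <= 1 -> k y < Num.max (k x) (k z)) ->
  exists a kbar, [/\ 0 <= a, a <= 1, bm (kbar : measurableTypeR R -> R),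
  forall x y, 0 <= x -> x <= y -> y <= 1 -> kbar y <= kbar x &
  [/\ forall x, a <= x -> kbar x = kbar a,
  forall Z, bm (Z : measurableTypeR R -> R) ->
    (forall x y, 0 <= x -> x <= y -> y <= 1 -> Z y <= Z x) ->
    mean mu (fun x => k x * Z x) <= mean mu (fun x => kbar x * Z x) &
  forall Z c, bm (Z : measurableTypeR R -> R) ->
    (forall x, a < x -> x <= 1 -> Z x = c) ->
    mean mu (fun x => k x * Z x) = mean mu (fun x => kbar x * Z x)]].
Proof.
move=> qc; apply: (@ironing R (mean mu)) => //.
- by move=> h h' bh bh'; exact: meanB.
- by move=> r h bh; exact: meanZ.
- by move=> a h h' bh bh'; exact: (le_mean01 law).
- by move=> t t1; rewrite mean_gt subr_gt0 F_lt1.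
- move=> t e e0; have [s st Fs] := F_left t e0; exists s => //.
  by apply: le_lt_trans Fs; apply: mean_between; exact: ltW.
Qed.

Lemma bm_mirror h : bm (h : measurableTypeR R -> R) ->
  bm (fun x : measurableTypeR R => h (1 - x) : R).
Proof. by apply: bm_comp; exact: measurable_funB. Qed.

(* Reflecting types by [x |-> 1 - x] and negating turns a quasi-concave virtual
   value pooled at the bottom into a quasi-convex one pooled at the top. *)
Lemma ironing_concave :
  (forall x y z, 0 <= x -> x < y -> y < z -> z <= 1 -> Num.min (k x) (k z) < k y) ->
  exists a kbar, [/\ 0 <= a, a <= 1, bm (kbar : measurableTypeR R -> R),
  forall x y, 0 <= x -> x <= y -> y <= 1 -> kbar y <= kbar x &
  [/\ forall x, x <= a -> kbar x = kbar a,
  forall Z, bm (Z : measurableTypeR R -> R) ->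
    (forall x y, 0 <= x -> x <= y -> y <= 1 -> Z y <= Z x) ->
    mean mu (fun x => k x * Z x) <= mean mu (fun x => kbar x * Z x) &
  forall Z c, bm (Z : measurableTypeR R -> R) ->
    (forall x, 0 <= x -> x < a -> Z x = c) ->
    mean mu (fun x => k x * Z x) = mean mu (fun x => kbar x * Z x)]].
Proof.
move=> qc; pose E (h : R -> R) := mean mu (fun x => h (1 - x)).
pose k' x := - k (1 - x).
have bk' : bm (k' : measurableTypeR R -> R).
  by have := bm_mirror bk => b; rewrite /k'; bm.
have sub1K (x : R) : 1 - (1 - x) = x by ring.
have [| | | | | |a [kbar [a0 a1 bkb kble [kbc kbi kbp]]]] := @ironing R E _ _ _ _ _ k' bk'.
- by move=> h h' bh bh'; apply: meanB; exact: bm_mirror.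
- by move=> r h bh; apply: meanZ; exact: bm_mirror.
- move=> a h h' bh bh' hh'; apply: (le_mean01 law (a := 1 - a)).
  + exact: bm_mirror.
  + exact: bm_mirror.
  + move=> x x0 x1 xa; apply: hh'; rewrite ?subr_ge0 ?gerBl//.
    by apply: contraNN xa => /eqP <-; rewrite sub1K.
- move=> t t1; have Ft : 0 < F mu (1 - t) by apply: F_gt0; rewrite subr_gt0.
  apply: lt_le_trans Ft _.
  have -> : F mu (1 - t) = mean mu (fun x => 1 - (1 - t < x)%R%:R).
    by rewrite meanB ?mean_cst ?mean_gt; [ring|exact: bm_cst|exact: bm_gt].
  apply: (le_mean01 law (a := 1 - t)).
  + by apply: bmB; [exact: bm_cst|exact: bm_gt].
  + exact: (bm_mirror (bm_gt t)).
  + move=> x _ _ xt; have [xl|xg] := ltP (1 - t) x.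
      by rewrite subrr.
    by rewrite subr0 (_ : t < 1 - x)// ltrBrDl -ltrBrDr lt_neqAle xt.
- move=> t e e0; have [s st Fs] := F_right (1 - t) e0; exists (1 - s); first lra.
  apply: le_lt_trans Fs; apply: le_trans (mean_between (ltW st)).
  apply: le_mean.
  + apply: (bm_mirror (h := fun x => (1 - s < x)%R%:R * (x < t)%R%:R)).
    by have h1 := @bm_gt R (1 - s); have h2 := @bm_ltq R t; bm.
  + by have h1 := @bm_gt R (1 - t); have h2 := @bm_ltq R s; bm.
  + move=> x; rewrite mulrC ltrD2l ltrN2.
    by rewrite (_ : (1 - x < t) = (1 - t < x)%R)// ltrBlDr addrC -ltrBlDr.
- move=> x y z x0 xy yz z1; rewrite /k' -oppr_min ltrN2 minC.
  by apply: qc; lra.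
exists (1 - a), (fun x => - kbar (1 - x)).
(* Test functions are reflected and negated together with [k]: monotonicity keeps its direction and
   the two signs cancel in the product. *)
have EZ Z (l : R -> R) : E (fun x => l x * - Z (1 - x)) =
    mean mu (fun x => - l (1 - x) * Z x).
  by apply: mean_ext => x; rewrite sub1K mulrN mulNr.
have kE Z : mean mu (fun x => - k' (1 - x) * Z x) = mean mu (fun x => k x * Z x).
  by apply: mean_ext => x; rewrite /k' sub1K opprK.
have bZ' (Z : R -> R) : bm (Z : measurableTypeR R -> R) ->
    bm (fun x : measurableTypeR R => - Z (1 - x) : R).
  by move=> bZ; apply: bmN; exact: bm_mirror.
split; [lra|lra| | |split].
- exact: bZ'.
- by move=> x y x0 xy y1; rewrite lerN2; apply: kble; lra.
- by move=> x xa; rewrite sub1K kbc//; lra.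
- move=> Z bZ Zle; rewrite -kE -!EZ; apply: kbi; first exact: bZ'.
  by move=> x y x0 xy y1; rewrite lerN2; apply: Zle; lra.
- move=> Z c bZ Zc; rewrite -kE -!EZ; apply: (kbp _ (- c)); first exact: bZ'.
  by move=> x ax x1; rewrite Zc//; lra.
Qed.

End IroningInstances.

(** Integrability is not assumed, because the objective may be -oo; positive and negative parts are
    compared separately. *)
Lemma le_integral_measurable {R : realType} {d} {T : measurableType d}
    (m : {measure set T -> \bar R}) (D : set T) (h k : T -> \bar R) :
  measurable D -> measurable_fun D h -> measurable_fun D k ->
  (forall x, D x -> h x <= k x)%E ->
  (\int[m]_(x in D) h x <= \int[m]_(x in D) k x)%E.
Proof.
move=> mD mh mk hk; rewrite [leLHS]integralE [leRHS]integralE.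
apply: leeB; apply: ge0_le_integral => //.
- exact: measurable_funepos.
- exact: measurable_funepos.
- move=> x Dx; rewrite !funeposE; have := hk x Dx.
  by move=> hkx; rewrite ge_max !le_max hkx lexx orbT.
- exact: measurable_funeneg.
- exact: measurable_funeneg.
- move=> x Dx; rewrite !funenegE; have := hk x Dx.
  by rewrite -leeN2 => hkx; rewrite ge_max !le_max hkx lexx orbT.
Qed.

(** * The objective of (P2) *)

Section Objective.
Context {R : realType}.
Variables (mu : probability (measurableTypeR R) R) (f g g' : R -> R) (alpha Q : R).
Hypotheses (law : type_law mu f) (cost : investment_cost g g').
Hypotheses (Q0 : 0 < Q) (Q1 : g' Q = 1) (alpha_gt0 : 0 < alpha).
Hypothesis J_incr : {in `[0, 1] &, {homo J mu f : x y / x < y}}.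

(* Precomposing with [clamp] turns functions measurable on [0, 1] into functions
   measurable on the whole line, with the same integrals. *)
Definition clamp (x : R) := Num.min (Num.max x 0) 1.

Lemma clamp_ge0 x : 0 <= clamp x.
Proof. by rewrite /clamp le_min le_max lexx orbT ler01. Qed.

Lemma clamp_le1 x : clamp x <= 1.
Proof. by rewrite /clamp ge_min lexx orbT. Qed.

Lemma clamp_id x : 0 <= x -> x <= 1 -> clamp x = x.
Proof. by move=> x0 x1; rewrite /clamp max_l// min_l. Qed.

Lemma clamp_homo x y : x <= y -> clamp x <= clamp y.
Proof.
move=> xy; rewrite /clamp le_min !ge_min lexx orbT andbT.
by rewrite ge_max !le_max xy lexx !orbT.
Qed.

Lemma clamp_in x : `[0, 1]%classic (clamp x).
Proof. by rewrite /= in_itv/= clamp_ge0 clamp_le1. Qed.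

Lemma measurable_clamp : measurable_fun setT (clamp : measurableTypeR R -> R).
Proof. by apply: nondecreasing_measurable => // x y; exact: clamp_homo. Qed.

Definition vcost (x : R) := - (alpha * J mu f (clamp x)).

Lemma vcost_noninc x y : x <= y -> vcost y <= vcost x.
Proof.
move=> xy; rewrite lerN2 ler_pM2l//; have := clamp_homo xy.
rewrite le_eqVlt => /predU1P[->//|cxy]; apply/ltW/J_incr => //;
  by rewrite in_itv/= clamp_ge0 clamp_le1.
Qed.

Lemma bm_vcost : bm (vcost : measurableTypeR R -> R).
Proof.
have b : bm (fun x : measurableTypeR R => - vcost x : R).
  apply: (@bm_monotone _ _ (`|vcost 0| + `|vcost 1|)) => [x y xy|x].
    by rewrite lerN2 vcost_noninc.
  rewrite normrN; have h (z : R) : vcost (clamp z) = vcost z.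
    by rewrite /vcost clamp_id ?clamp_ge0 ?clamp_le1.
  have h0 := vcost_noninc (clamp_ge0 x); have h1 := vcost_noninc (clamp_le1 x).
  rewrite h in h0 h1; rewrite ler_norml.
  have := ler_norm (vcost 0); have := ler_norm (- vcost 1); rewrite normrN.
  have := normr_ge0 (vcost 0); have := normr_ge0 (vcost 1); lra.
rewrite (_ : vcost = fun x => - (- vcost x)); first by bm.
by apply/funext => x; rewrite opprK.
Qed.

Lemma integral_profiles (h : R -> R -> R) : bm2 h ->
  (\int[(mu \x mu)%E]_(t in @type_profiles R) (h t.1 t.2)%:E =
   (mean mu (fun x => mean mu (h x)))%:E)%E.
Proof.
move=> bh; pose ind (x : R) : R := (1 - (x < 0)%R%:R) * (1 - (1 < x)%R%:R).
have bi : bm (ind : measurableTypeR R -> R).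
  by have h1 := @bm_ltq R 0; have h2 := @bm_gt R 1; rewrite /ind; bm.
have i1 (x : R) : 0 <= x -> x <= 1 -> ind x = 1.
  by move=> x0 x1; rewrite /ind ltNge x0 ltNge x1 subr0 mulr1.
transitivity (\int[(mu \x mu)%E]_t (h t.1 t.2 * (ind t.1 * ind t.2))%:E)%E.
  rewrite integral_mkcond; apply: eq_integral => -[x y] _.
  rewrite patchE; case: ifPn => [|] /=.
    rewrite inE => -[/=]; rewrite !in_itv/= => /andP[x0 x1] /andP[y0 y1].
    by rewrite !i1// !mulr1.
  rewrite notin_setE /type_profiles /setX /= !in_itv/= => nxy.
  rewrite /ind; case: (ltP x 0) nxy => x0; first by rewrite subrr !(mul0r, mulr0).
  case: (ltP 1 x) => x1; first by rewrite subrr !(mul0r, mulr0).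
  case: (ltP y 0) => y0; first by rewrite subrr !(mul0r, mulr0).
  case: (ltP 1 y) => y1; first by rewrite subrr !(mul0r, mulr0).
  by case.
have bhi : bm2 (fun x y => h x y * (ind x * ind y)) by rewrite /bm2; bm.
rewrite (@integral_prod_mean _ _ _ _ _ mu mu (fun x y => h x y * (ind x * ind y)))//.
congr EFin; apply: (eq_mean01 law (a := 0)); [bm|bm|] => x x0 x1 _.
have b1 := bm2_right x bh; have b2 := bm2_right x bhi.
apply: (eq_mean01 law (a := 0)) => // y y0 y1 _.
by rewrite !i1// !mulr1.
Qed.

Definition trunc (p : R -> R) (x : R) := Num.min (p (clamp x)) Q.

Definition win (y1 : R * R -> R) (x y : R) := y1 (clamp x, clamp y).

Section Feasible.
Variables (p1 p2 : R -> R) (y1 y2 : R * R -> R).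
Hypothesis feas : feasible p1 p2 y1 y2.

Let clamp_profile (x y : R) : @type_profiles R (clamp x, clamp y).
Proof. by split; exact: clamp_in. Qed.

Let meas_clamp (p : R -> R) : measurable_fun (`[0, 1]%classic : set R) p ->
  measurable_fun setT (fun x : measurableTypeR R => p (clamp x)).
Proof.
move=> mp; apply: (@measurable_comp _ _ _ _ _ _ (`[0, 1]%classic : set R)) => //.
- by move=> _ [x _ <-]; exact: clamp_in.
- exact: measurable_clamp.
Qed.

Lemma win01 x y : 0 <= win y1 x y <= 1.
Proof.
have h := clamp_profile x y; have := z1_ge0 feas h; have := z2_ge0 feas h.
by have := z_sum1 feas h; rewrite /win; lra.
Qed.

Lemma bm_win : bm2 (win y1).
Proof.
split; last by exists 1 => t; have /andP[h0 h1] := win01 t.1 t.2; rewrite ger0_norm.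
apply: (@measurable_comp _ _ _ _ _ _ (@type_profiles R) y1).
- exact: measurableX.
- by move=> _ [t _ <-]; exact: clamp_profile.
- exact: z1_measurable feas.
- apply: measurable_fun_pair; apply: measurableT_comp => //; exact: measurable_clamp.
Qed.

Let p1_ge0 x : 0 <= p1 (clamp x).
Proof. by apply: (q1_ge0 feas); exact: clamp_in. Qed.

Let p2_ge0 x : 0 <= p2 (clamp x).
Proof. by apply: (q2_ge0 feas); exact: clamp_in. Qed.

Let trunc01 p x : 0 <= p (clamp x) -> 0 <= trunc p x <= Q.
Proof. by move=> p0; rewrite /trunc le_min p0 (ltW Q0) ge_min lexx orbT. Qed.

Let bm_trunc (p : R -> R) : measurable_fun (`[0, 1]%classic : set R) p ->
  (forall x, 0 <= p (clamp x)) -> bm (trunc p : measurableTypeR R -> R).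
Proof.
move=> mp p0; split.
  by apply: measurable_minr => //; exact: meas_clamp.
by exists Q => x; have /andP[h0 h1] := trunc01 (p0 x); rewrite ger0_norm.
Qed.

Lemma trunc1P : bm (trunc p1 : measurableTypeR R -> R) /\
  forall x, 0 <= trunc p1 x <= Q.
Proof.
by split => [|x]; [exact: bm_trunc (q1_measurable feas) p1_ge0 | exact: trunc01].
Qed.

Lemma trunc2P : bm (trunc p2 : measurableTypeR R -> R) /\
  forall x, 0 <= trunc p2 x <= Q.
Proof.
by split => [|x]; [exact: bm_trunc (q2_measurable feas) p2_ge0 | exact: trunc01].
Qed.

Let integrand (P1 P2 : R -> R) (x y : R) :=
  ((P1 x + vcost x) * win y1 x y - g (P1 x)) +
  ((P2 y + vcost y) * (1 - win y1 x y) - g (P2 y)).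

Let objectiveE : objective mu f g alpha p1 p2 y1 y2 =
  (\int[(mu \x mu)%E]_(t in @type_profiles R)
    (integrand (p1 \o clamp) (p2 \o clamp) t.1 t.2)%:E)%E.
Proof.
apply: eq_integral => -[x y]; rewrite inE => xy; have := xy.
move=> [/=]; rewrite !in_itv/= => /andP[x0 x1] /andP[y0 y1'].
rewrite /integrand /win /vcost /= !clamp_id//.
by congr EFin; rewrite -(z_sum1 feas xy) [y1 _ + _]addrC addrK.
Qed.

Let bm_integrand : bm2 (integrand (trunc p1) (trunc p2)).
Proof.
have [b1 h1] := trunc1P; have [b2 h2] := trunc2P.
have bg1 := @bm_fst _ _ _ _ (measurableTypeR R) _ (bm_g cost b1 h1).
have bg2 := @bm_snd _ _ _ (measurableTypeR R) _ _ (bm_g cost b2 h2).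
have bv := bm_vcost; have bw := bm_win.
by rewrite /bm2 /integrand; bm.
Qed.

Let trunc_better p z : 0 <= p -> 0 <= z -> z <= 1 ->
  p * z - g p <= Num.min p Q * z - g (Num.min p Q).
Proof.
move=> p0 z0 z1; have [pQ|Qp] := leP p Q => //.
have := g_steep cost Q0 Q1 (ltW Qp).
have : (p - Q) * z <= p - Q by rewrite ler_piMr// subr_ge0 ltW.
rewrite mulrBl; lra.
Qed.

(* Qualities above [Q] are dominated since [g' >= 1] there; truncating makes the
   integrand bounded even when the objective is -oo. *)
Lemma objective_le : (objective mu f g alpha p1 p2 y1 y2 <=
  (payoff mu g vcost (trunc p1) (trunc p2) (win y1))%:E)%E.
Proof.
rewrite objectiveE -(integral_profiles bm_integrand).
apply: le_integral_measurable.
- exact: measurableX.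
- have mw : measurable_fun setT (fun t : measurableTypeR R * measurableTypeR R =>
      win y1 t.1 t.2) by case: bm_win.
  have mv : measurable_fun setT (vcost : measurableTypeR R -> R) by case: bm_vcost.
  have m1 := meas_clamp (q1_measurable feas); have m2 := meas_clamp (q2_measurable feas).
  have mg1 := measurable_g cost m1 p1_ge0; have mg2 := measurable_g cost m2 p2_ge0.
  apply: measurable_funTS; apply/measurable_EFinP.
  apply: measurable_funD; apply: measurable_funB.
  + apply: measurable_funM => //; apply: measurable_funD.
      by apply: (measurableT_comp m1); exact: measurable_fst.
    by apply: (measurableT_comp mv); exact: measurable_fst.
  + by apply: (measurableT_comp mg1); exact: measurable_fst.
  + apply: measurable_funM.
      apply: measurable_funD.
        by apply: (measurableT_comp m2); exact: measurable_snd.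
      by apply: (measurableT_comp mv); exact: measurable_snd.
    by apply: measurable_funB => //.
  + by apply: (measurableT_comp mg2); exact: measurable_snd.
- by apply: measurable_funTS; apply/measurable_EFinP; case: bm_integrand.
- move=> [x y] _; rewrite lee_fin /integrand /=; have /andP[w0 w1] := win01 x y.
  have h1 := trunc_better (p1_ge0 x) w0 w1.
  have w0' : 0 <= 1 - win y1 x y by lra.
  have w1' : 1 - win y1 x y <= 1 by lra.
  have h2 := trunc_better (p2_ge0 y) w0' w1'.
  rewrite !mulrDl /trunc; lra.
Qed.

Lemma objective_eq : (forall x, 0 <= x -> x <= 1 -> p1 x <= Q) ->
  (forall x, 0 <= x -> x <= 1 -> p2 x <= Q) ->
  objective mu f g alpha p1 p2 y1 y2 =
  (payoff mu g vcost (trunc p1) (trunc p2) (win y1))%:E.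
Proof.
move=> p1Q p2Q; rewrite objectiveE -(integral_profiles bm_integrand).
apply: eq_integral => -[x y] _; congr EFin.
have e1 : trunc p1 x = p1 (clamp x).
  by rewrite /trunc min_l// p1Q ?clamp_ge0 ?clamp_le1.
have e2 : trunc p2 y = p2 (clamp y).
  by rewrite /trunc min_l// p2Q ?clamp_ge0 ?clamp_le1.
by rewrite /integrand /= e1 e2.
Qed.

End Feasible.

Let phi := phi mu g' Q0.

(** At [q = phi x] one has [1 - g' q = F x], so [F_inv] returns [x]: read along [phi], the function
    in the curvature assumption is [kappa] up to the constant [alpha]. *)
Lemma kappa_q_sym x : 0 <= x -> x <= 1 ->
  [/\ 0 <= phi x, g' (phi x) <= 1, g' (phi x) = surv mu x &
   alpha * xi mu f (g' (phi x)) - phi x = alpha + kappa mu g' Q0 vcost x].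
Proof.
move=> x0 x1; have [q0 qQ gq] := phiP mu cost Q0 Q1 x.
split => //; first by rewrite /phi gq; have /andP[] := surv01 mu x.
rewrite /phi gq /xi /surv opprB addrCA subrr addr0 /F_inv pinvKV.
- by rewrite /kappa /vcost clamp_id//; ring.
- move=> y z; rewrite !inE/= !in_itv/= => /andP[y0 y1] /andP[z0 z1] Fyz.
  by have [yz|zy|//] := ltgtP y z; [have := F_lt law y0 yz z1|have := F_lt law z0 zy y1];
    rewrite Fyz ltxx.
- by rewrite inE/= in_itv/= x0.
Qed.

Lemma phi_lt x y : 0 <= x -> x < y -> y <= 1 -> phi y < phi x.
Proof.
move=> x0 xy y1; have [qx0 _ gx] := phiP mu cost Q0 Q1 x.
have [qy0 _ gy] := phiP mu cost Q0 Q1 y.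
rewrite ltNge; apply/negP => /(g'_le cost qx0).
by rewrite gx gy leNgt ltrD2l ltrN2 (F_lt law).
Qed.

Lemma between (a b c : R) : a < b -> b < c ->
  exists t, [/\ 0 < t < 1 & b = t * c + (1 - t) * a].
Proof.
move=> ab bc; exists ((b - a) / (c - a)); have ca : 0 < c - a by lra.
split; last by field; lra.
apply/andP; split; first by rewrite divr_gt0// subr_gt0.
by rewrite ltr_pdivrMr// mul1r; lra.
Qed.

(** Quasi-convexity depends only on the order of points, and [phi] is strictly decreasing: the
    quality of a middle type is a convex combination of the outer two. *)
Lemma kappa_convex : sufficiently_convex mu f g' alpha ->
  forall x y z, 0 <= x -> x < y -> y < z -> z <= 1 ->
  kappa mu g' Q0 vcost y <
  Num.max (kappa mu g' Q0 vcost x) (kappa mu g' Q0 vcost z).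
Proof.
move=> cvx x y z x0 xy yz z1.
have [y0 y1] : 0 <= y /\ y <= 1 by lra.
have [z0 x1] : 0 <= z /\ x <= 1 by lra.
have [qx gx _ kx] := kappa_q_sym x0 x1; have [qy gy _ ky] := kappa_q_sym y0 y1.
have [qz gz _ kz] := kappa_q_sym z0 z1.
have [t [t01 E]] := between (phi_lt y0 yz z1) (phi_lt x0 xy y1).
have xz : phi x != phi z by rewrite gt_eqF// (phi_lt x0 (lt_trans xy yz) z1).
have := cvx (phi x) (phi z) t (conj qx gx) (conj qz gz) xz t01.
rewrite -E kx ky kz -addr_maxr ltrD2l; exact.
Qed.

Lemma kappa_concave : sufficiently_concave mu f g' alpha ->
  forall x y z, 0 <= x -> x < y -> y < z -> z <= 1 ->
  Num.min (kappa mu g' Q0 vcost x) (kappa mu g' Q0 vcost z) <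
  kappa mu g' Q0 vcost y.
Proof.
move=> cve x y z x0 xy yz z1.
have [y0 y1] : 0 <= y /\ y <= 1 by lra.
have [z0 x1] : 0 <= z /\ x <= 1 by lra.
have [qx gx _ kx] := kappa_q_sym x0 x1; have [qy gy _ ky] := kappa_q_sym y0 y1.
have [qz gz _ kz] := kappa_q_sym z0 z1.
have [t [t01 E]] := between (phi_lt y0 yz z1) (phi_lt x0 xy y1).
have xz : phi x != phi z by rewrite gt_eqF// (phi_lt x0 (lt_trans xy yz) z1).
have := cve (phi x) (phi z) t (conj qx gx) (conj qz gz) xz t01.
rewrite -E kx ky kz -addr_minr ltrD2l; exact.
Qed.

End Objective.

(** * Censored solutions *)

Section Censored.
Context {R : realType}.
Variables (mu : probability (measurableTypeR R) R) (f g g' : R -> R) (alpha Q : R).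
Hypotheses (law : type_law mu f) (cost : investment_cost g g').
Hypotheses (Q0 : 0 < Q) (Q1 : g' Q = 1) (alpha_gt0 : 0 < alpha).
Hypothesis J_incr : {in `[0, 1] &, {homo J mu f : x y / x < y}}.

Let phi := phi mu g' Q0.
Let kappa := kappa mu g' Q0 (vcost mu f alpha).
Let T2 := (measurableTypeR R * measurableTypeR R)%type.

Lemma winE (z : R * R -> R) x y :
  0 <= x -> x <= 1 -> 0 <= y -> y <= 1 -> win z x y = z (x, y).
Proof. by move=> x0 x1 y0 y1; rewrite /win !clamp_id. Qed.

Lemma feasible_phi (u1 u2 : R -> R) (b : R * R -> bool) :
  measurable_fun setT (u1 : measurableTypeR R -> measurableTypeR R) ->
  measurable_fun setT (u2 : measurableTypeR R -> measurableTypeR R) ->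
  measurable_fun setT (b : T2 -> bool) ->
  feasible (phi \o u1) (phi \o u2) (fun t => (b t)%:R) (fun t => 1 - (b t)%:R).
Proof.
move=> mu1 mu2 mb; have [mphi _] := bm_phi mu cost Q0 Q1.
have [mz _] := @bm_bool R _ _ _ mb.
split.
- by apply: measurable_funTS; exact: measurableT_comp mu1.
- by apply: measurable_funTS; exact: measurableT_comp mu2.
- exact: measurable_funTS.
- by apply: measurable_funTS; exact: measurable_funB.
- by move=> x _; have [] := phiP mu cost Q0 Q1 (u1 x).
- by move=> x _; have [] := phiP mu cost Q0 Q1 (u2 x).
- by move=> t _; case: (b t).
- by move=> t _; case: (b t); rewrite ?subrr ?subr0.
- by move=> t _; rewrite addrC subrK.
Qed.

Lemma solves_P2_intro (kbar u1 u2 : R -> R) (b : R * R -> bool) :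
  let z := fun t => (b t)%:R in
  bm (kbar : measurableTypeR R -> R) ->
  (forall Z, bm (Z : measurableTypeR R -> R) ->
    (forall x y, 0 <= x -> x <= y -> y <= 1 -> Z y <= Z x) ->
    mean mu (fun x => kappa x * Z x) <= mean mu (fun x => kbar x * Z x)) ->
  measurable_fun setT (u1 : measurableTypeR R -> measurableTypeR R) ->
  measurable_fun setT (u2 : measurableTypeR R -> measurableTypeR R) ->
  measurable_fun setT (b : T2 -> bool) ->
  (forall x, 0 <= x -> x <= 1 -> 0 <= u1 x <= 1) ->
  (forall x, 0 <= x -> x <= 1 -> 0 <= u2 x <= 1) ->
  (forall x y, 0 <= x -> x <= 1 -> 0 <= y -> y <= 1 -> y != u1 x ->
    b (x, y) = (u1 x < y)) ->
  (forall x y, 0 <= x -> x <= 1 -> 0 <= y -> y <= 1 -> x != u2 y ->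
    ~~ b (x, y) = (u2 y < x)) ->
  mean mu (fun x => kappa x * reduced1 mu (win z) x) =
    mean mu (fun x => kbar x * reduced1 mu (win z) x) ->
  mean mu (fun x => kappa x * reduced2 mu (win z) x) =
    mean mu (fun x => kbar x * reduced2 mu (win z) x) ->
  (forall x y, 0 <= x -> x <= 1 -> 0 <= y -> y <= 1 ->
    if b (x, y) then kbar y <= kbar x else kbar x <= kbar y) ->
  solves_P2 mu f g alpha (phi \o u1) (phi \o u2) z (fun t => 1 - z t).
Proof.
move=> z bkbar iron mu1 mu2 mb u1_in u2_in bu1 bu2 pool1 pool2 winner.
have feas := feasible_phi mu1 mu2 mb; split => // p1 p2 y1 y2 feas'.
have bc := bm_vcost alpha_gt0 J_incr; have c_le := vcost_noninc alpha_gt0 J_incr.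
have w0t1 x y : 0 <= x -> x <= 1 -> 0 <= y -> y <= 1 -> y != u1 x ->
    win z x y = (u1 x < y)%R%:R.
  by move=> x0 x1 y0 y1' yx; rewrite winE// /z bu1.
have w0t2 x y : 0 <= x -> x <= 1 -> 0 <= y -> y <= 1 -> x != u2 y ->
    1 - win z x y = (u2 y < x)%R%:R.
  move=> x0 x1 y0 y1' yx; rewrite winE// /z -bu2//.
  by case: (b (x, y)); rewrite ?subrr ?subr0.
have win_max x y : 0 <= x -> x <= 1 -> 0 <= y -> y <= 1 ->
    Num.max (kbar x) (kbar y) <= kbar x * win z x y + kbar y * (1 - win z x y).
  move=> x0 x1 y0 y1'; rewrite winE// /z; have := winner x y x0 x1 y0 y1'.
  case: (b (x, y)) => h; first by rewrite mulr1 subrr mulr0 addr0 ge_max lexx.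
  by rewrite mulr0 add0r subr0 mulr1 ge_max lexx andbT.
have phi_le x : phi x <= Q by have [] := phiP mu cost Q0 Q1 x.
apply: (le_trans (objective_le law cost Q0 Q1 alpha_gt0 J_incr feas')).
have q1Q x : 0 <= x -> x <= 1 -> (phi \o u1) x <= Q.
  by move=> _ _; exact: phi_le.
have q2Q x : 0 <= x -> x <= 1 -> (phi \o u2) x <= Q.
  by move=> _ _; exact: phi_le.
rewrite [leRHS](objective_eq law cost Q0 alpha_gt0 J_incr feas q1Q q2Q) lee_fin.
have [bq1 q101] := trunc1P Q0 feas; have [bq2 q201] := trunc2P Q0 feas.
have [bp1 p101] := trunc1P Q0 feas'; have [bp2 p201] := trunc2P Q0 feas'.
rewrite (payoff_eq law cost Q1 bc (bm_win feas) w0t1 w0t2 bq1 bq2 q101 q201).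
- exact: (payoff_le law cost Q1 bc c_le bkbar iron (bm_win feas) u1_in u2_in
    w0t1 w0t2 pool1 pool2 win_max bp1 bp2 p101 p201 (bm_win feas') (win01 feas')).
- by move=> x x0 x1; rewrite /trunc /= clamp_id// min_l.
- by move=> x x0 x1; rewrite /trunc /= clamp_id// min_l.
Qed.

Lemma right_censored_solves : sufficiently_convex mu f g' alpha ->
  exists2 x0 : R, x0 \in `[0, 1] &
  exists q1 q2 : R -> R, exists z1 z2 : R * R -> R,
    right_censored mu g' x0 q1 q2 z1 z2 /\ solves_P2 mu f g alpha q1 q2 z1 z2.
Proof.
move=> cvx; have bc := bm_vcost alpha_gt0 J_incr.
have bk : bm (kappa : measurableTypeR R -> R).
  exact: (bm_kappa mu cost Q0 Q1 bc).
have [x0 [kbar [x00 x01 bkbar kbar_le [kbar_x0 iron pool]]]] :=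
  ironing_convex law bk (kappa_convex law cost Q0 Q1 cvx).
(* Above [x0] firm 2 never wins: cutoff 1, quality [phi 1]. Type [x0] itself still beats every
   higher type of firm 1, hence the weak inequality in [u2]. *)
pose u1 x := Num.min x0 x; pose u2 x := if x <= x0 then x else 1.
pose b (t : R * R) := (Num.min x0 t.1 < t.2)%R.
have mid : measurable_fun setT (id : measurableTypeR R -> measurableTypeR R) by [].
have mu1 : measurable_fun setT (u1 : measurableTypeR R -> measurableTypeR R).
  exact: measurable_minr.
have mu2 : measurable_fun setT (u2 : measurableTypeR R -> measurableTypeR R).
  by apply: measurable_fun_ifT => //; exact: measurable_fun_ler.
have mb : measurable_fun setT (b : T2 -> bool).
  apply: measurable_fun_ltr; last exact: measurable_snd.
  by apply: measurable_minr => //; exact: measurable_fst.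
exists x0; first by rewrite in_itv/= x00.
exists (phi \o u1), (phi \o u2), (fun t => (b t)%:R), (fun t => 1 - (b t)%:R).
have feas := feasible_phi mu1 mu2 mb.
split.
  split => //.
  - by move=> x _; rewrite (q_symE mu cost Q0 Q1).
  - by move=> x _ xx0; rewrite (q_symE mu cost Q0 Q1) /= /u2 ltW.
  - by move=> x _ xx0; rewrite (q_symE mu cost Q0 Q1) /= /u2 leNgt xx0.
(* The allocation compares [y] with [min x0 x]; as [kbar] is flat from [x0] on, this picks a winner
   with the larger [kbar]. *)
have kbar_min x : kbar (Num.min x0 x) = kbar x.
  by have [xx0|xx0] := leP x0 x => //; rewrite kbar_x0.
apply: (solves_P2_intro bkbar iron mu1 mu2 mb).
- by move=> x h0 h1; rewrite /u1 le_min x00 h0 ge_min h1 orbT.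
- by move=> x h0 h1; rewrite /u2; case: ifP => _; rewrite ?h0 ?ler01 ?lexx.
- by [].
- move=> x y h0 h1 k0 k1 xy; rewrite /b -leNgt le_min /=; move: xy; rewrite /u2.
  case: ifP => [yx0 xy|yx0 _] /=.
    by rewrite lt_neqAle eq_sym xy.
  by rewrite ltNge h1.
- apply: (pool _ (mean mu (fun y => (x0 < clamp y)%R%:R))).
    exact: (bm_reduced1 mu (bm_win feas)).
  move=> x xx0 x1; apply: mean_ext => y.
  by rewrite /win /b /= (clamp_id (ltW (le_lt_trans x00 xx0)) x1) min_l// ltW.
- apply: (pool _ 0); first exact: (bm_reduced2 mu (bm_win feas)).
  move=> y yx0 y1; rewrite -[RHS](mean_cst mu); apply: mean_ext => x.
  rewrite /win /b /= (clamp_id (ltW (le_lt_trans x00 yx0)) y1).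
  by rewrite gt_min yx0 subrr.
- move=> x y h0 h1 k0 k1; rewrite /b /=; case: ltP => xy.
    rewrite -(kbar_min x); apply: kbar_le => //; last exact: ltW.
    by rewrite le_min x00.
  by rewrite -(kbar_min x); apply: kbar_le => //; rewrite ge_min h1 orbT.
Qed.

Lemma left_censored_solves : sufficiently_concave mu f g' alpha ->
  exists2 x0 : R, x0 \in `[0, 1] &
  exists q1 q2 : R -> R, exists z1 z2 : R * R -> R,
    left_censored mu g' x0 q1 q2 z1 z2 /\ solves_P2 mu f g alpha q1 q2 z1 z2.
Proof.
move=> cve; have bc := bm_vcost alpha_gt0 J_incr.
have bk : bm (kappa : measurableTypeR R -> R).
  exact: (bm_kappa mu cost Q0 Q1 bc).
have [x0 [kbar [x00 x01 bkbar kbar_le [kbar_x0 iron pool]]]] :=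
  ironing_concave law bk (kappa_concave law cost Q0 Q1 cve).
(* Up to and including [x0] firm 1 always wins: cutoff 0, quality [phi 0]. A pooled type of firm 2
   wins only against types above [x0], whatever its own value. *)
pose u1 x := if x <= x0 then 0 else x; pose u2 x := Num.max x0 x.
pose b (t : R * R) := (t.1 <= Num.max x0 t.2)%R.
have mid : measurable_fun setT (id : measurableTypeR R -> measurableTypeR R) by [].
have mu1 : measurable_fun setT (u1 : measurableTypeR R -> measurableTypeR R).
  by apply: measurable_fun_ifT => //; exact: measurable_fun_ler.
have mu2 : measurable_fun setT (u2 : measurableTypeR R -> measurableTypeR R).
  exact: measurable_maxr.
have mb : measurable_fun setT (b : T2 -> bool).
  apply: measurable_fun_ler; first exact: measurable_fst.
  by apply: measurable_maxr => //; exact: measurable_snd.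
exists x0; first by rewrite in_itv/= x00.
exists (phi \o u1), (phi \o u2), (fun t => (b t)%:R), (fun t => 1 - (b t)%:R).
have feas := feasible_phi mu1 mu2 mb.
split.
  split.
  - by move=> t _; rewrite /b leNgt; case: (_ < _)%R; rewrite ?subrr ?subr0.
  - by move=> t _; rewrite opprB addrCA subrr addr0.
  - by move=> x _; rewrite (q_symE mu cost Q0 Q1).
  - by move=> x _ xx0; rewrite (q_symE mu cost Q0 Q1) /= /u1 leNgt xx0.
  - by move=> x _ xx0; rewrite (q_symE mu cost Q0 Q1) /= /u1 ltW.
have kbar_max x : kbar (Num.max x0 x) = kbar x.
  by have [xx0|xx0] := leP x x0 => //; rewrite [RHS]kbar_x0.
apply: (solves_P2_intro bkbar iron mu1 mu2 mb).
- by move=> x h0 h1; rewrite /u1; case: ifP => _; rewrite ?h0 ?ler01 ?lexx.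
- by move=> x h0 h1; rewrite /u2 le_max h0 orbT ge_max x01 h1.
- move=> x y h0 h1 k0 k1 xy; rewrite /b /=; move: xy; rewrite /u1 le_max.
  case: ifP => [xx0 y0|_ yx] /=; first by rewrite lt_neqAle eq_sym y0 k0.
  by rewrite lt_neqAle eq_sym yx.
- by move=> x y h0 h1 k0 k1 xy; rewrite /b -ltNge.
- apply: (pool _ 1); first exact: (bm_reduced1 mu (bm_win feas)).
  move=> x h0 xx0; rewrite -[RHS](mean_cst mu); apply: mean_ext => y.
  rewrite /win /b /= (clamp_id h0 (ltW (lt_le_trans xx0 x01))).
  by rewrite le_max (ltW xx0).
- apply: (pool _ (mean mu (fun x => 1 - (clamp x <= x0)%R%:R))).
    exact: (bm_reduced2 mu (bm_win feas)).
  move=> y k0 yx0; apply: mean_ext => x.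
  by rewrite /win /b /= (clamp_id k0 (ltW (lt_le_trans yx0 x01))) max_l// ltW.
- move=> x y h0 h1 k0 k1; rewrite /b /=; case: leP => xy.
    by rewrite -(kbar_max y); apply: kbar_le => //; rewrite ge_max x01.
  by rewrite -(kbar_max y); apply: kbar_le; [rewrite le_max x00|exact: ltW|].
Qed.

End Censored.

Theorem proposition8 (R : realType) (mu : probability (measurableTypeR R) R)
    (f g g' : R -> R) (alpha : R)
    (mu_law : type_law mu f)
    (J_incr : {in `[0, 1] &, {homo J mu f : x y / x < y}})
    (alpha_gt0 : 0 < alpha)
    (g_cost : investment_cost g g') :
  (sufficiently_convex mu f g' alpha ->
     exists2 x0 : R, x0 \in `[0, 1] &
     exists q1 q2 : R -> R, exists z1 z2 : R * R -> R,
       right_censored mu g' x0 q1 q2 z1 z2 /\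
       solves_P2 mu f g alpha q1 q2 z1 z2) /\
  (sufficiently_concave mu f g' alpha ->
     exists2 x0 : R, x0 \in `[0, 1] &
     exists q1 q2 : R -> R, exists z1 z2 : R * R -> R,
       left_censored mu g' x0 q1 q2 z1 z2 /\
       solves_P2 mu f g alpha q1 q2 z1 z2).
Proof.
have [Q Q0 Q1] := g'_reach1 g_cost.
split; first exact: (right_censored_solves mu_law g_cost Q0 Q1).
exact: (left_censored_solves mu_law g_cost Q0 Q1).
Qed.
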